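(* Suppose that $\lambda_n\to\lambda\in[0,1]$. Then, as $n\to\infty$, \[ \frac{N_{d_n^*}}{n}\to 1-\lambda \quad\text{and}\quad \frac{N_{d_n^*+1}}{n}\to\lambda \qquad\text{in probability.}\] In particular, with probability $1-o(1)$ all but $o(n)$ vertices of $G_n$ are at distance $d_n^*$ or $d_n^*+1$ from vertex $1$.
   Context: Let $(\alpha_n)_{n\ge1}$ be a sequence in $(0,\infty)$ with $0<\liminf_n\alpha_n\le\limsup_n\alpha_n<\infty$, let $q_n=\alpha_n\log n/n$, and let $G_n\sim\mathcal G(n,q_n)$ be an Erdős–Rényi random graph on the vertex set $\{1,\dots,n\}$. Define $d_n^*=\min\{d\in\mathbb Z:(nq_n)^d\ge n/(\log\log n)^2\}$ and define $\lambda_n\in(0,1)$ by $\log(1/\lambda_n)=(nq_n)^{d_n^*}/n$. For an integer $d\ge0$, $N_d$ denotes the number of vertices of $G_n$ at graph distance exactly $d$ from vertex $1$. *)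

(* Defs.v *)
From mathcomp Require Import all_boot all_order all_algebra.
From mathcomp Require Import all_classical all_reals all_analysis.
Set Implicit Arguments.
Unset Strict Implicit.
Unset Printing Implicit Defensive.
Import Order.TTheory GRing.Theory Num.Theory.
Import numFieldNormedType.Exports.
Local Open Scope ring_scope.

Section GraphDistance.
Variables (T : finType) (e : rel T).

Definition walk (x y : T) (k : nat) : bool :=
  [exists p : k.-tuple T, path e x p && (last x p == y)].

Definition at_distance (x y : T) (k : nat) : bool :=
  walk x y k && [forall j : 'I_k, ~~ walk x y j].

End GraphDistance.

(* A simple graph on n vertices is given by its edge set, a set of
   two-element subsets of 'I_n. *)
Definition vpairs (n : nat) : {set {set 'I_n}} := [set f : {set 'I_n} | #|f| == 2].

Definition adj (n : nat) (E : {set {set 'I_n}}) : rel 'I_n :=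
  [rel x y | [set x; y]%SET \in E].

(* Vertex 1 of {1, ..., n} is the ordinal of value 0; the existential only
   serves to make the definition total, as 'I_0 is empty. *)
Definition sphere (n : nat) (E : {set {set 'I_n}}) (d : int) : {set 'I_n} :=
  if d is Posz k then
    [set v : 'I_n |
      [exists u : 'I_n, (val u == 0%N) && at_distance (adj E) u v k]]
  else finset.set0.

Definition Ndist (n : nat) (E : {set {set 'I_n}}) (d : int) : nat :=
  #|sphere E d|.

Section ErdosRenyi.
Variable R : realType.

(* The law of G(n, q): each of the pairs is an edge independently with
   probability q. *)
Definition er_weight (n : nat) (q : R) (E : {set {set 'I_n}}) : R :=
  \prod_(f in vpairs n) (if f \in E then q else 1 - q).

Definition er_prob (n : nat) (q : R) (A : pred {set {set 'I_n}}) : R :=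
  \sum_(E : {set {set 'I_n}} | (E \subset vpairs n) && A E) er_weight q E.

(* Convergence in probability, to the constant c, of the random variables X n
   of the graph G(n, q n). When q n > 1 the weights do not form a probability;
   below this is the case for finitely many n only, so that limits are not
   affected. *)
Definition er_cvg_in_prob (q : nat -> R)
    (X : forall n, {set {set 'I_n}} -> R) (c : R) : Prop :=
  forall eps : R, 0 < eps ->
    ((fun n => er_prob (q n) (fun E : {set {set 'I_n}} => eps < `|X n E - c|))
       @ \oo --> (0 : R))%classic.

Variable alpha : nat -> R.

Definition qseq (n : nat) : R := alpha n * ln n%:R / n%:R.

Definition dstar_set (n : nat) : set int :=
  [set d : int | n%:R / ln (ln n%:R) ^+ 2 <= (n%:R * qseq n) ^ d]%classic.

(* The minimum of dstar_set n; it exists for all large n, and the value is the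
   dummy 0 when it does not. *)
Definition dstar (n : nat) : int :=
  xget 0 [set d : int | dstar_set n d /\
                        forall d' : int, dstar_set n d' -> d <= d']%classic.

(* The solution of ln (1 / lambda) = (n q_n) ^ d_n^* / n, see ln_lambda. *)
Definition lambda_seq (n : nat) : R :=
  expR (- ((n%:R * qseq n) ^ dstar n / n%:R)).

End ErdosRenyi.

Lemma er_prob_total (R : realType) (n : nat) (q : R) :
  er_prob q (fun _ : {set {set 'I_n}} => true) = 1.
Proof.
rewrite /er_prob.
under eq_bigl do rewrite andbT.
transitivity (\prod_(f : {set 'I_n}) ((if f \in vpairs n then q else 0) +
                    (if f \in vpairs n then 1 - q else 1))).
  rewrite bigA_distr [RHS](bigID (fun E : {set {set 'I_n}} => E \subset vpairs n)) /=.
  rewrite [X in _ = _ + X]big1 ?addr0; last first.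
    move=> E /fintype.subsetPn[f fE fv]; rewrite (bigD1 f) //= fE (negbTE fv).
    by rewrite mul0r.
  apply: eq_big => [//|E /fintype.subsetP sE].
  rewrite /er_weight big_mkcond /=; apply: eq_bigr => f _.
  have [fE|fE] := boolP (f \in E); first by rewrite (sE _ fE).
  by [].
by rewrite big1 // => f _; case: ifP => _; rewrite ?subrKC ?add0r // addrC subrK.
Qed.

Lemma lambda_seq_gt0 (R : realType) (alpha : nat -> R) (n : nat) :
  0 < lambda_seq alpha n.
Proof. exact: expR_gt0. Qed.

Lemma lambda_seq_lt1 (R : realType) (alpha : nat -> R) (n : nat) :
  (1 < n)%N -> 0 < alpha n -> lambda_seq alpha n < 1.
Proof.
move=> n1 a0; have n0 : 0 < n%:R :> R by rewrite ltr0n ltnW.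
rewrite expR_lt1 oppr_lt0 divr_gt0 // exprz_gt0 // mulr_gt0 // divr_gt0 //.
by rewrite mulr_gt0 // ln_gt0 // ltr1n.
Qed.

Lemma ln_lambda (R : realType) (alpha : nat -> R) (n : nat) :
  ln (1 / lambda_seq alpha n) =
  (n%:R * qseq alpha n) ^ dstar alpha n / n%:R.
Proof. by rewrite div1r -expRN opprK expRK. Qed.

(* Main.v *)
Require Import Defs.
From mathcomp Require Import all_boot all_order all_algebra.
From mathcomp Require Import all_classical all_reals all_analysis.
From mathcomp Require Import ring lra.
Set Implicit Arguments.
Unset Strict Implicit.
Unset Printing Implicit Defensive.
Import Order.TTheory GRing.Theory Num.Theory.
Import numFieldNormedType.Exports.
Local Open Scope ring_scope.

(* Explore G(n, q) from vertex 1 layer by layer; let B_k and S_k be the ball and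
   the sphere of radius k, m = n q, and d* = k + 1. Given the first k layers, each
   vertex outside B_k stays outside B_(k+1) with probability (1 - q)^|S_k|, and
   these events are pairwise independent, so that the conditional mean and
   variance of |S_(k+1)| are explicit. Hence, unconditionally,
   E|S_k| <= m^k, E|S_k|^2 <= (1 + 2/m) m^(2k) and E|S_k| >= m^k (1 - 8 m^k / n),
   which gives E(|S_k| / m^k - 1)^2 <= 2/m + 16 m^k / n -> 0, as
   m^k < n / (log log n)^2 by minimality of d*. One more step turns this into
   |S_(k+1)| / n ~ 1 - exp(- q m^k) = 1 - lambda_n in L^2, uniformly in the size of
   q m^k because |exp(- mu z) - exp(- mu)| <= 2 |z - 1|. Finally
   q |S_(k+1)| >= m / (16 (log log n)^2) -> oo with high probability, so all but
   o(n) vertices are reached by step k + 2. *)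

(** * Walks and graph distance, by recursion on the length *)

Section Walks.
Context (T : finType) (e : rel T).
Implicit Types x y z : T.

Lemma walk0 x y : walk e x y 0 = (x == y).
Proof.
apply/existsP/idP => [[p]|/eqP->]; first by rewrite (tuple0 p).
by exists [tuple]; rewrite /= eqxx.
Qed.

Lemma walkS x y k : walk e x y k.+1 = [exists z, walk e x z k && e z y].
Proof.
apply/existsP/existsP => [[p]|[z /andP[/existsP[p /andP[ep /eqP lz]] ezy]]].
  case: p => s; case/lastP: s => // s z /=; rewrite size_rcons eqSS => ss.
  rewrite rcons_path last_rcons => /andP[/andP[es el] /eqP <-].
  exists (last x s); rewrite el andbT.
  by apply/existsP; exists (Tuple ss); rewrite es eqxx.
exists [tuple of rcons p y].
by rewrite rcons_path last_rcons ep lz ezy eqxx.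
Qed.

Lemma at_distance0 x y : at_distance e x y 0 = (x == y).
Proof.
by rewrite /at_distance walk0; case: eqP => //= _; apply/forallP => -[].
Qed.

Lemma at_distanceP x y k :
  reflect (walk e x y k /\ forall j, (j < k)%N -> ~~ walk e x y j)
          (at_distance e x y k).
Proof.
apply: (iffP andP) => -[w h]; split => //.
  by move=> j jk; have /forallP/(_ (Ordinal jk)) := h.
by apply/forallP => j; apply: h.
Qed.

(** Dropping the last vertex of a shortest walk leaves a shortest walk: a shorter walk to [z],
    followed by the edge to [y], would reach [y] too early. *)
Lemma at_distanceS x y k : at_distance e x y k.+1 =
  [forall j : 'I_k.+1, ~~ walk e x y j] &&
  [exists z, at_distance e x z k && e z y].
Proof.
apply/at_distanceP/andP => [[]|[/forallP h /existsP[z /andP[/at_distanceP[xz _] zy]]]].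
  rewrite walkS => /existsP[z /andP[xz zy]] h; split.
    by apply/forallP => j; apply: h.
  apply/existsP; exists z; rewrite zy andbT; apply/at_distanceP; split => // j jk.
  apply/negP => xzj; have /negP := h j.+1 jk; apply.
  by rewrite walkS; apply/existsP; exists z; rewrite xzj zy.
split; last by move=> j jk; exact: h (Ordinal jk).
by rewrite walkS; apply/existsP; exists z; rewrite xz.
Qed.

End Walks.

(** * Breadth-first exploration and the edges it leaves unexamined *)

Section Exploration.
Context (n : nat) (r : 'I_n).
Implicit Types (E : {set {set 'I_n}}) (k : nat).

(* Breadth-first exploration from r: the ball and the sphere of radius k. *)
Fixpoint explore E k : {set 'I_n} * {set 'I_n} :=
  if k is k'.+1 then
    let: (B, F) := explore E k' in
    let F' := [set v | v \notin B & [exists u in F, [set u; v]%SET \in E]] in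
    (B :|: F', F')%SET
  else ([set r], [set r])%SET.

Definition gball E k := (explore E k).1.
Definition shell E k := (explore E k).2.

Lemma shellS E k : shell E k.+1 =
  [set v | v \notin gball E k & [exists u in shell E k, [set u; v]%SET \in E]].
Proof. by rewrite /shell /gball /=; case: (explore E k). Qed.

Lemma ballS E k : gball E k.+1 = (gball E k :|: shell E k.+1)%SET.
Proof. by rewrite /shell /gball /=; case: (explore E k). Qed.

Lemma shell_sub_ball E k : shell E k \subset gball E k.
Proof. by case: k => [//|k]; rewrite ballS finset.subsetUr. Qed.

Lemma disjoint_ball_shell E k : [disjoint gball E k & shell E k.+1].
Proof.
rewrite disjoint_sym; apply/pred0P => v /=; rewrite shellS inE.
by case: (v \in gball E k); rewrite ?andbF.
Qed.

Lemma card_ballS E k : #|gball E k.+1| = (#|gball E k| + #|shell E k.+1|)%N.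
Proof.
rewrite ballS cardsU; move: (disjoint_ball_shell E k).
by rewrite -finset.setI_eq0 => /eqP->; rewrite cards0 subn0.
Qed.

(** Both equivalences go through one induction, since each new sphere is cut out by the previous
    ball as well as the previous sphere. *)
Lemma shell_ball_walk E k v :
  (v \in shell E k) = at_distance (adj E) r v k /\
  (v \in gball E k) = [exists j : 'I_k.+1, walk (adj E) r v j].
Proof.
elim: k v => [|k IH] v.
  rewrite at_distance0 /shell /gball /= finset.in_set1 eq_sym; split => //.
  apply/idP/existsP => [rv|[[[|//] ?]]]; last by rewrite /= walk0.
  by exists ord0; rewrite walk0.
have Es : (v \in shell E k.+1) = at_distance (adj E) r v k.+1.
  rewrite shellS inE (IH v).2 at_distanceS negb_exists; congr (_ && _).
  by apply: eq_existsb => u; rewrite (IH u).1.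
split => //; rewrite ballS finset.in_setU Es (IH v).2.
apply/orP/existsP => [[/existsP[j wj]|/andP[w _]]|[j wj]].
- by exists (widen_ord (leqnSn _) j).
- by exists ord_max.
(* If no walk of length at most [k] reaches [v], the given walk has length exactly [k.+1] and is
   shortest. *)
case: (boolP [exists j : 'I_k.+1, walk (adj E) r v j]) => [ex|nex]; first by left.
right; have Ej : val j = k.+1.
  apply/eqP; rewrite eqn_leq -ltnS ltn_ord leqNgt; apply/negP => jk.
  by move/existsP: nex; apply; exists (Ordinal jk).
apply/at_distanceP; split; first by rewrite -Ej.
by move=> i ik; rewrite negb_exists in nex; exact: (forallP nex (Ordinal ik)).
Qed.

Lemma sphereE E k : val r = 0%N -> sphere E k%:Z = shell E k.
Proof.
move=> r0; apply/finset.setP => v; rewrite inE (shell_ball_walk E k v).1.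
apply/existsP/idP => [[u /andP[/eqP u0]]|rv]; last by exists r; rewrite r0 eqxx.
by rewrite (_ : u = r) //; apply: val_inj; rewrite u0 r0.
Qed.

(** The ball of radius k + 2 is the disjoint union of the ball of radius k and the two spheres, so a
    vertex on neither sphere is either too near or too far. *)
Lemma card_outside_two_spheres E k : val r = 0%N ->
  #|~: (sphere E k.+1%:Z :|: sphere E k.+2%:Z)%SET| =
  (#|gball E k| + (n - #|gball E k.+2|))%N.
Proof.
move=> r0; rewrite !sphereE // cardsCs finset.setCK card_ord.
have dS : (shell E k.+1 :&: shell E k.+2 = finset.set0)%SET.
  apply/eqP; rewrite finset.setI_eq0; apply: disjointWl (shell_sub_ball E k.+1) _.
  exact: disjoint_ball_shell.
rewrite cardsU dS cards0 subn0.
have := max_card (mem (gball E k.+2)); rewrite card_ord !card_ballS.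
move: #|gball E k| #|shell E k.+1| #|shell E k.+2| => b s t h.
by rewrite addnBA // -addnA subnDl.
Qed.

(** Isolates the fresh randomness of step k + 1: once [W] avoids the current ball, only the edges
    between the current sphere and [W] matter. *)
Lemma disjoint_ballS (W : {set 'I_n}) E k :
  [disjoint W & gball E k.+1] =
  [disjoint W & gball E k] &&
  [disjoint [set [set uv.1; uv.2] | uv in finset.setX (shell E k) W]%SET & E].
Proof.
apply/idP/andP => [dW|[dW dE]].
  have dWk : [disjoint W & gball E k].
    by apply: disjointWr dW; rewrite ballS finset.subsetUl.
  split => //; apply/pred0P => f /=; apply/negP => /andP[/imsetP[[u v]]].
  rewrite finset.in_setX /= => /andP[uS vW] -> uvE.
  have /pred0P/(_ v)/= := dW; rewrite vW /= ballS finset.in_setU shellS inE.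
  have /pred0P/(_ v)/= := dWk; rewrite vW /= => -> /=.
  by move/negbT/negP; apply; apply/existsP; exists u; rewrite uS.
apply/pred0P => v /=; apply/negP => /andP[vW]; rewrite ballS finset.in_setU.
have /pred0P/(_ v)/= := dW; rewrite vW /= => -> /=; rewrite shellS inE.
case/andP => _ /existsP[u /andP[uS uvE]].
have /pred0P/(_ [set u; v]%SET)/= := dE; rewrite uvE andbT => /negP; apply.
by apply/imsetP; exists (u, v); rewrite // finset.in_setX uS.
Qed.

(** Each edge that decides the first k steps has an endpoint in the ball of radius k - 1, which is
    [B :\: F]. The edges from [F] to the outside of [B] thus stay independent of the state
    reached. *)
Lemma explore_local E E' k (B F : {set 'I_n}) :
  (forall f : {set 'I_n}, ~~ [disjoint f & (B :\: F)%SET] ->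
    (f \in E) = (f \in E')) ->
  explore E k = (B, F) -> explore E' k = (B, F).
Proof.
elim: k B F => [//|k IH] B' F' agree.
have : explore E k = (gball E k, shell E k) by rewrite /gball /shell; case: explore.
have sub := shell_sub_ball E k; have dis := disjoint_ball_shell E k.
move=> Ek ES; have := ballS E k.
rewrite {1}/gball ES /= => EB.
have ES' : F' = shell E k.+1 by rewrite /shell ES.
(* Removing the newest sphere gives back the previous ball, so the agreement covers all edges at the
   previous sphere. *)
have EBS : (B' :\: F' = gball E k)%SET.
  rewrite EB -ES' finset.setDUl finset.setDv finset.setU0.
  by apply/finset.setDidPl; rewrite ES'.
rewrite EBS in agree.
have Ek' : explore E' k = (gball E k, shell E k).
  apply: IH Ek => f fBS; apply: agree; apply: contra fBS.
  by apply: disjointWr; apply: finset.subsetDl.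
rewrite -ES /= Ek Ek'.
suff -> : [set v | v \notin gball E k & [exists u in shell E k, [set u; v]%SET \in E']]
  = [set v | v \notin gball E k & [exists u in shell E k, [set u; v]%SET \in E]] by [].
apply/finset.setP => v; rewrite !inE; congr (_ && _); apply: eq_existsb => u.
case: (boolP (u \in shell E k)) => //= uS; rewrite agree //.
apply/pred0Pn; exists u => /=; rewrite !inE eqxx /=.
exact: (fintype.subsetP sub).
Qed.

End Exploration.

Lemma disjointsU1 (T : finType) (x : T) (A B : {set T}) :
  [disjoint (x |: A)%SET & B] = (x \notin B) && [disjoint A & B].
Proof. by rewrite !finset.disjoints_subset finset.subUset finset.sub1set finset.in_setC. Qed.

(** * Expectation over G(n, q) and independence of edges *)

Section Expectation.
Context (R : realType) (n : nat) (q : R).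
Implicit Types (X Y : {set {set 'I_n}} -> R) (E : {set {set 'I_n}}).

Definition er_exp X : R := 
  \sum_(E : {set {set 'I_n}} | E \subset vpairs n) er_weight q E * X E.

Lemma er_probE (A : pred {set {set 'I_n}}) :
  er_prob q A = er_exp (fun E => (A E)%:R).
Proof.
rewrite /er_prob big_mkcondr; apply: eq_bigr => E _.
by case: (A E); rewrite ?mulr1 ?mulr0.
Qed.

Lemma eq_er_exp X Y : (forall E, X E = Y E) -> er_exp X = er_exp Y.
Proof. by move=> XY; apply: eq_bigr => E _; rewrite XY. Qed.

Lemma er_exp_cst c : er_exp (fun=> c) = c.
Proof.
rewrite /er_exp -big_distrl /= -[RHS]mul1r; congr (_ * _).
rewrite -(er_prob_total n q) /er_prob.
by apply: eq_bigl => E; rewrite andbT.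
Qed.

Lemma er_expD X Y : er_exp (fun E => X E + Y E) = er_exp X + er_exp Y.
Proof. by rewrite /er_exp -big_split; apply: eq_bigr => E _; rewrite mulrDr. Qed.

Lemma er_expZ c X : er_exp (fun E => c * X E) = c * er_exp X.
Proof. by rewrite /er_exp big_distrr; apply: eq_bigr => E _; rewrite mulrCA. Qed.

Lemma er_expB X Y : er_exp (fun E => X E - Y E) = er_exp X - er_exp Y.
Proof.
rewrite -[in RHS]mulN1r -er_expZ -er_expD.
by apply: eq_er_exp => E; rewrite mulN1r.
Qed.

Lemma er_exp_sum (I : finType) (P : pred I) (X : I -> {set {set 'I_n}} -> R) :
  er_exp (fun E => \sum_(i | P i) X i E) = \sum_(i | P i) er_exp (X i).
Proof.
rewrite /er_exp exchange_big /=; apply: eq_bigr => E _.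
by rewrite big_distrr.
Qed.

(* Resampling the single edge f: X * er_weight is summed over the pairs
   {E, E + f}, on which X is constant. *)
Lemma er_exp_nonedge f X : f \in vpairs n ->
  (forall E, X (f |: E)%SET = X E) ->
  er_exp (fun E => X E * (f \notin E)%:R) = (1 - q) * er_exp X.
Proof.
move=> fv Xf; pose c E := \prod_(g in vpairs n | g != f) (if g \in E then q else 1 - q).
have wN E : f \notin E -> er_weight q E = (1 - q) * c E.
  by move=> fE; rewrite /er_weight (bigD1 f) //= (negbTE fE).
have wA E : er_weight q (f |: E)%SET = q * c E.
  rewrite /er_weight (bigD1 f) //= finset.setU11; congr (_ * _).
  by apply: eq_bigr => g /andP[_ gf]; rewrite finset.in_setU1 (negbTE gf).
have -> : er_exp X =
      \sum_(E : {set {set 'I_n}} | (E \subset vpairs n) && (f \notin E)) c E * X E.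
  rewrite /er_exp (bigID (fun E : {set {set 'I_n}} => f \in E)) /=.
  rewrite (reindex_onto (fun E => f |: E)%SET (fun E => E :\ f)%SET) /=; last first.
    by move=> E /andP[_ fE]; rewrite finset.setD1K.
  rewrite [X in X + _](eq_bigl (fun E : {set {set 'I_n}} => (E \subset vpairs n) && (f \notin E))).
    rewrite -big_split; apply: eq_bigr => E /andP[_ fE] /=.
    by rewrite wA wN // Xf; ring.
  move=> E; rewrite finset.setU11 andbT finset.subUset finset.sub1set fv /=.
  congr (_ && _); apply/eqP/idP => [<-|fE]; first by rewrite finset.setD11.
  by rewrite finset.setU1K.
rewrite /er_exp big_distrr /= big_mkcondr /=; apply: eq_bigr => E _.
by case: ifP => fE; rewrite ?mulr0 // mulr1 wN // mulrA.
Qed.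

(** The pairs of [A] are removed one at a time: after splitting off [f], the product of [X] with the
    indicator for [A :\ f] still ignores [f], so each pair contributes a factor 1 - q. *)
Lemma er_exp_nonedges (A : {set {set 'I_n}}) X : A \subset vpairs n ->
  (forall E E', (forall f, f \notin A -> (f \in E) = (f \in E')) -> X E = X E') ->
  er_exp (fun E => X E * [disjoint A & E]%:R) = (1 - q) ^+ #|A| * er_exp X.
Proof.
elim: {A}_.+1 {-2}A (ltnSn #|A|) => // N IH A AN sA XA.
have [->|[f fA]] := set_0Vmem A.
  rewrite cards0 expr0 mul1r; apply: eq_er_exp => E.
  by rewrite (_ : [disjoint _ & _]) ?mulr1 // -finset.setI_eq0 finset.set0I.
have Af : A = (f |: (A :\ f))%SET by rewrite finset.setD1K.
have cA : #|A| = #|(A :\ f)%SET|.+1 by rewrite (cardsD1 f A) fA.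
rewrite cA exprS -mulrA -IH; last 3 first.
- by rewrite -ltnS -cA.
- exact: fintype.subset_trans (finset.subsetDl _ _) sA.
- move=> E E' h; apply: XA => g gA; apply: h.
  by apply: contra gA; rewrite finset.in_setD1 => /andP[].
rewrite -(@er_exp_nonedge f).
- apply: eq_er_exp => E; rewrite -mulrA -natrM mulnb; congr (_ * _%:R).
  by rewrite {1}Af disjointsU1 andbC.
- exact: (fintype.subsetP sA).
- move=> E; congr (_ * _%:R).
    apply: XA => g gA; rewrite finset.in_setU1; case: eqP => // gf.
    by rewrite gf fA in gA.
  rewrite -!finset.setI_eq0; congr (nat_of_bool (_ == _)).
  apply/finset.setP => g; rewrite !inE.
  by case: eqP.
Qed.

End Expectation.
Arguments er_exp {R n} q X.

(** * Order properties of the expectation and Markov's inequality *)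

Section Monotonicity.
Context (R : realType) (n : nat) (q : R).
Hypothesis q01 : 0 <= q <= 1.
Implicit Types (X Y : {set {set 'I_n}} -> R) (E : {set {set 'I_n}}).

Lemma er_weight_ge0 E : 0 <= er_weight q E.
Proof.
case/andP: q01 => q0 q1.
by apply: prodr_ge0 => f _; case: ifP => _ //; rewrite subr_ge0.
Qed.

Lemma ler_er_exp X Y : (forall E, X E <= Y E) -> er_exp q X <= er_exp q Y.
Proof. by move=> XY; apply: ler_sum => E _; rewrite ler_wpM2l // er_weight_ge0. Qed.

Lemma er_exp_ge0 X : (forall E, 0 <= X E) -> 0 <= er_exp q X.
Proof. by move=> X0; rewrite -(er_exp_cst n q 0); exact: ler_er_exp. Qed.

Lemma er_markov (A : pred {set {set 'I_n}}) X (t : R) : 0 < t ->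
  (forall E, 0 <= X E) -> (forall E, A E -> t <= X E) ->
  er_prob q A <= er_exp q X / t.
Proof.
move=> t0 X0 AX; rewrite er_probE mulrC -er_expZ; apply: ler_er_exp => E.
rewrite mulrC ler_pdivlMr //; case: (boolP (A E)) => [/AX|_]; by rewrite ?mul1r ?mul0r.
Qed.

End Monotonicity.

(** * Conditional mean and variance of one exploration step *)

Section OneStep.
Context (R : realType) (n : nat) (q : R) (r : 'I_n).
Implicit Types (E : {set {set 'I_n}}) (k : nat).
Implicit Types h : {set 'I_n} * {set 'I_n} -> R.

(** The factor [h] plays the part of conditioning on the first k layers. The expectation is split
    over the possible states (B, F); the event of being in such a state does not depend on the pairs
    joining F to [W], so all of these are absent with an independent factor 1 - q each. *)
Lemma er_exp_disjoint_ballS h k (W : {set 'I_n}) :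
  er_exp q (fun E => h (explore r E k) * [disjoint W & gball r E k.+1]%:R) =
  er_exp q (fun E => h (explore r E k) *
    ([disjoint W & gball r E k]%:R * (1 - q) ^+ (#|shell r E k| * #|W|))).
Proof.
pose atst s E : R := (explore r E k == s)%:R.
have split_state (X : {set {set 'I_n}} -> R) :
    er_exp q X = \sum_s er_exp q (fun E => atst s E * X E).
  rewrite -er_exp_sum; apply: eq_er_exp => E.
  rewrite (bigD1 (explore r E k)) //= /atst eqxx mul1r big1 ?addr0 // => s.
  by rewrite eq_sym => /negbTE->; rewrite mul0r.
rewrite split_state [RHS]split_state; apply: eq_bigr => -[B F] _.
(* The sum runs over all pairs of sets; a pair with F not inside B is never a state of the
   exploration. *)
have [sFB|nsFB] := boolP (F \subset B); last first.
  apply: eq_er_exp => E; rewrite /atst; case: eqP => [EBF|]; last by rewrite !mul0r.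
  by have := shell_sub_ball r E k; rewrite /shell /gball EBF /= (negbTE nsFB).
pose A := [set [set uv.1; uv.2] | uv in finset.setX F W]%SET.
transitivity (h (B, F) * [disjoint W & B]%:R *
    er_exp q (fun E => atst (B, F) E * [disjoint A & E]%:R)).
  rewrite -er_expZ; apply: eq_er_exp => E; rewrite /atst.
  case: eqP => [EBF|]; last by rewrite !(mul0r, mulr0).
  by rewrite disjoint_ballS /gball /shell EBF /= -mulnb natrM; ring.
transitivity (h (B, F) * [disjoint W & B]%:R * (1 - q) ^+ (#|F| * #|W|) *
    er_exp q (atst (B, F))); last first.
  rewrite -er_expZ; apply: eq_er_exp => E; rewrite /atst.
  case: eqP => [EBF|]; last by rewrite !(mul0r, mulr0).
  by rewrite /gball /shell EBF /=; ring.
have [dWB|] := boolP [disjoint W & B]; last by rewrite !(mul0r, mulr0).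
have BW u : u \in B -> u \in W = false.
  by move=> uB; have /pred0P/(_ u)/= := dWB; rewrite uB andbT.
rewrite -!mulrA; congr (_ * (_ * _)).
(* Forgetting the order of (u, v) loses nothing: u lies in B and v does not. *)
have -> : (#|F| * #|W|)%N = #|A|.
  rewrite card_in_imset ?cardsX // => -[u v] [u' v'].
  rewrite !finset.in_setX /= => /andP[uF vW] /andP[u'F v'W] e.
  have uB := fintype.subsetP sFB _ uF; have u'B := fintype.subsetP sFB _ u'F.
  have : u \in [set u'; v']%SET by rewrite -e !inE eqxx.
  have : v \in [set u'; v']%SET by rewrite -e !inE eqxx orbT.
  rewrite !inE => /orP[/eqP vu'|/eqP->]; first by rewrite -vu' in u'B; rewrite (BW v) in vW.
  by move=> /orP[/eqP->//|/eqP uv']; rewrite -uv' (BW u) in v'W.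
apply: er_exp_nonedges.
  apply/fintype.subsetP => f /imsetP[[u v]]; rewrite finset.in_setX /= => /andP[uF vW] ->.
  rewrite inE cards2; case: (eqVneq u v) => // uv.
  by rewrite -uv (BW u) // in vW; apply: (fintype.subsetP sFB).
move=> E E' EE'; rewrite /atst; congr (_%:R); congr nat_of_bool.
(* A pair in [A] joins F to a vertex outside B, hence misses B minus F, and [explore_local]
   applies. *)
have loc E1 E2 : (forall f, f \notin A -> (f \in E1) = (f \in E2)) ->
    explore r E1 k = (B, F) -> explore r E2 k = (B, F).
  move=> E12; apply: explore_local => f fBF; apply: E12; apply: contra fBF.
  case/imsetP => -[u v]; rewrite finset.in_setX /= => /andP[uF vW] ->.
  apply/pred0P => w /=; rewrite !inE.
  case: eqP => [->|_] /=; first by rewrite uF.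
  case: eqP => [->|_] //=; case: (boolP (v \in B)) => [/BW|]; by rewrite ?vW ?andbF.
by apply/eqP/eqP; apply: loc => // f fA; rewrite EE'.
Qed.

Definition outside E k : R := #|~: gball r E k|%:R.
Definition shsize E k : R := #|shell r E k|%:R.
Definition basize E k : R := #|gball r E k|%:R.
(* The conditional probability, given the first k layers, that a vertex outside
   the ball of radius k stays outside the ball of radius k + 1. *)
Definition avoid E k : R := (1 - q) ^+ #|shell r E k|.

Lemma outside_sum E k : outside E k = \sum_v [disjoint [set v]%SET & gball r E k]%:R.
Proof.
rewrite /outside -sum1_card natr_sum big_mkcond /=; apply: eq_bigr => v _.
by rewrite inE disjoints1; case: (v \in gball r E k).
Qed.

(** The diagonal is separated because two distinct vertices survive a step with the square of the
    probability for one. *)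
Lemma outside_sqr E k : outside E k ^+ 2 = outside E k +
  \sum_v \sum_(w | w != v) [disjoint [set v; w]%SET & gball r E k]%:R.
Proof.
rewrite [in RHS]outside_sum expr2 {1}outside_sum mulr_suml -big_split /=.
apply: eq_bigr => v _; rewrite outside_sum mulr_sumr (bigD1 v) //=; congr (_ + _).
  by rewrite -natrM mulnb andbb.
by apply: eq_bigr => w _; rewrite -natrM mulnb disjointsU1 !disjoints1.
Qed.

Lemma er_exp_outside h k :
  er_exp q (fun E => h (explore r E k) * outside E k.+1) =
  er_exp q (fun E => h (explore r E k) * (outside E k * avoid E k)).
Proof.
transitivity (\sum_v er_exp q (fun E =>
    h (explore r E k) * [disjoint [set v]%SET & gball r E k.+1]%:R)).
  rewrite -er_exp_sum; apply: eq_er_exp => E.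
  by rewrite outside_sum mulr_sumr.
under eq_bigr do rewrite er_exp_disjoint_ballS.
rewrite -er_exp_sum; apply: eq_er_exp => E; rewrite -mulr_sumr outside_sum mulr_suml.
by congr (_ * _); apply: eq_bigr => v _; rewrite cards1 muln1.
Qed.

Lemma er_exp_outside_sqr h k :
  er_exp q (fun E => h (explore r E k) * outside E k.+1 ^+ 2) =
  er_exp q (fun E => h (explore r E k) *
    (outside E k * avoid E k + (outside E k ^+ 2 - outside E k) * avoid E k ^+ 2)).
Proof.
transitivity (er_exp q (fun E => h (explore r E k) * outside E k.+1) +
  \sum_v \sum_(w | w != v) er_exp q (fun E =>
    h (explore r E k) * [disjoint [set v; w]%SET & gball r E k.+1]%:R)).
  under eq_bigr do rewrite -er_exp_sum.
  rewrite -er_exp_sum -er_expD; apply: eq_er_exp => E.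
  rewrite outside_sqr mulrDr; congr (_ + _).
  by rewrite mulr_sumr; apply: eq_bigr => v _; rewrite mulr_sumr.
rewrite er_exp_outside.
under eq_bigr do under eq_bigr do rewrite er_exp_disjoint_ballS.
under eq_bigr do rewrite -er_exp_sum.
rewrite -er_exp_sum -er_expD; apply: eq_er_exp => E.
rewrite mulrDr; congr (_ + _); rewrite outside_sqr addrAC subrr add0r.
rewrite mulr_suml mulr_sumr; apply: eq_bigr => v _.
rewrite mulr_suml mulr_sumr; apply: eq_bigr => w wv.
by rewrite cards2 eq_sym wv /avoid exprM.
Qed.

Lemma shsizeS E k : shsize E k.+1 = outside E k - outside E k.+1.
Proof.
rewrite /shsize /outside.
have H j : (#|gball r E j| + #|~: gball r E j|%SET = n)%N by rewrite cardsC card_ord.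
have := H k; have := H k.+1; rewrite card_ballS.
move=> e1 e2; have : (#|shell r E k.+1| + #|~: gball r E k.+1|%SET)%N = #|~: gball r E k|%SET.
  by apply/eqP; rewrite -(eqn_add2l #|gball r E k|) addnA e1 e2.
by move=> <-; rewrite natrD addrK.
Qed.

Lemma outsideE E k : outside E k = n%:R - basize E k.
Proof.
by rewrite /outside /basize -[in n%:R](card_ord n) -(cardsC (gball r E k)) natrD addrAC subrr add0r.
Qed.

Lemma er_exp_shell h k :
  er_exp q (fun E => h (explore r E k) * shsize E k.+1) =
  er_exp q (fun E => h (explore r E k) * (outside E k * (1 - avoid E k))).
Proof.
transitivity (er_exp q (fun E => h (explore r E k) * outside E k) -
    er_exp q (fun E => h (explore r E k) * outside E k.+1)).
  by rewrite -er_expB; apply: eq_er_exp => E; rewrite shsizeS mulrBr.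
rewrite er_exp_outside -er_expB; apply: eq_er_exp => E.
by ring.
Qed.

(** Given the first k layers, the vertices outside survive pairwise independently with probability
    [avoid E k], so their count has a binomial-type variance. The proof expands the square around
    the conditional mean [g], itself a function of the state. *)
Lemma er_exp_shell_var k :
  er_exp q (fun E => (shsize E k.+1 - outside E k * (1 - avoid E k)) ^+ 2) =
  er_exp q (fun E => outside E k * (avoid E k * (1 - avoid E k))).
Proof.
pose g (s : {set 'I_n} * {set 'I_n}) : R := #|~: s.1|%SET%:R * (1 - q) ^+ #|s.2|.
have gE E : g (explore r E k) = outside E k * avoid E k by [].
transitivity (er_exp q (fun E => (fun=> 1) (explore r E k) * outside E k.+1 ^+ 2)
   - 2 * er_exp q (fun E => g (explore r E k) * outside E k.+1)
   + er_exp q (fun E => g (explore r E k) ^+ 2)).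
  rewrite -er_expZ -er_expB -er_expD; apply: eq_er_exp => E.
  by rewrite shsizeS gE; move: (outside E k) (avoid E k) (outside E k.+1) => x y z; ring.
rewrite (er_exp_outside_sqr (fun=> 1)) er_exp_outside -er_expZ -er_expB -er_expD.
apply: eq_er_exp => E; rewrite gE.
by move: (outside E k) (avoid E k) => x y; ring.
Qed.

(** The second moment is the conditional variance plus the square of the conditional mean, as the
    cross term averages out. *)
Lemma er_exp_shell_sqr k :
  er_exp q (fun E => shsize E k.+1 ^+ 2) =
  er_exp q (fun E => outside E k * (avoid E k * (1 - avoid E k))
                     + (outside E k * (1 - avoid E k)) ^+ 2).
Proof.
pose g (s : {set 'I_n} * {set 'I_n}) : R := #|~: s.1|%SET%:R * (1 - (1 - q) ^+ #|s.2|).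
have gE E : g (explore r E k) = outside E k * (1 - avoid E k) by [].
rewrite er_expD -er_exp_shell_var.
transitivity (er_exp q (fun E => (shsize E k.+1 - outside E k * (1 - avoid E k)) ^+ 2)
  + 2 * er_exp q (fun E => g (explore r E k) * shsize E k.+1)
  - er_exp q (fun E => (outside E k * (1 - avoid E k)) ^+ 2)).
  rewrite -er_expZ -er_expD -er_expB; apply: eq_er_exp => E.
  by rewrite gE; move: (outside E k) (avoid E k) (shsize E k.+1) => x y z; ring.
rewrite er_exp_shell -addrA; congr (_ + _).
rewrite -er_expZ -er_expB; apply: eq_er_exp => E; rewrite gE.
by move: (outside E k) (avoid E k) => x y; ring.
Qed.

End OneStep.

(** * Inequalities for powers of 1 - p and for the exponential *)

Section ElementaryInequalities.
Context (R : realType).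
Implicit Types x y p mu : R.

Lemma bernoulli_le p k : 0 <= p <= 1 -> 1 - (1 - p) ^+ k <= p * k%:R.
Proof.
move=> /andP[p0 p1]; elim: k => [|k IH]; first by rewrite expr0 mulr0 subrr.
rewrite exprS -natr1; have : 0 <= (1 - p) ^+ k <= 1.
  by rewrite exprn_ge0 ?subr_ge0 // exprn_ile1 // ?subr_ge0 // lerBlDr lerDl.
by move=> /andP[a0 a1]; nra.
Qed.

Lemma bernoulli_ge p k : 0 <= p <= 1 ->
  p * k%:R - (p * k%:R) ^+ 2 <= 1 - (1 - p) ^+ k.
Proof.
move=> /andP[p0 p1]; elim: k => [|k IH].
  by rewrite expr0 mulr0 subrr expr2 mulr0 subrr.
rewrite [(1 - p) ^+ _]exprS -natr1; set a := (1 - p) ^+ k in IH *; set s := k%:R in IH *.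
have s0 : 0 <= s by rewrite ler0n.
have h : (1 - p) * (a - (1 - p * s + (p * s) ^+ 2)) <= 0.
  by rewrite mulr_ge0_le0 ?subr_ge0 //; lra.
have h1 : 0 <= p ^+ 2 * s by rewrite mulr_ge0 ?sqr_ge0.
have h2 : 0 <= p * (p * s) ^+ 2 by rewrite mulr_ge0 ?sqr_ge0.
have h3 : 0 <= p ^+ 2 by rewrite sqr_ge0.
by lra.
Qed.

Lemma expRN_leV x : 0 < x -> expR (- x) <= x^-1.
Proof.
move=> x0; rewrite expRN lef_pV2 ?posrE ?expR_gt0 //.
by apply: le_trans (expR_ge1Dx x); rewrite lerDr.
Qed.

Lemma mul_expRN_le1 x : x * expR (- x) <= 1.
Proof.
rewrite expRN ler_pdivrMr ?expR_gt0 // mul1r.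
by apply: le_trans (expR_ge1Dx x); rewrite lerDr.
Qed.

Lemma onem_expR_le p k : 0 <= p <= 1 -> (1 - p) ^+ k <= expR (- (p * k%:R)).
Proof.
move=> /andP[p0 p1]; rewrite -mulNr expRM_natr lerXn2r ?nnegrE ?subr_ge0 ?expR_ge0 //.
exact: expR_ge1Dx.
Qed.

(* (1 - p)^-1 = 1 + p / (1 - p) <= exp (p / (1 - p)) <= exp (p + 2 p^2),
   and x exp (- x) <= 1 is used for x = k p. *)
Lemma onem_expR_ge p k : 0 <= p <= 1 / 2 ->
  expR (- (p * k%:R)) - (1 - p) ^+ k <= 2 * p.
Proof.
move=> /andP[p0 p1]; have q0 : 0 < 1 - p by lra.
have h : expR (- (p + 2 * p ^+ 2)) <= 1 - p.
  rewrite expRN invf_ple ?posrE ?expR_gt0 //.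
  apply: le_trans (expR_ge1Dx _); rewrite -div1r ler_pdivrMr //.
  by have := sqr_ge0 p; nra.
have : expR (- (p + 2 * p ^+ 2)) ^+ k <= (1 - p) ^+ k.
  by rewrite lerXn2r ?nnegrE ?expR_ge0 // ltW.
rewrite -expRM_natr.
have -> : - (p + 2 * p ^+ 2) * k%:R = - (p * k%:R) + - (2 * p * (p * k%:R)) by ring.
rewrite expRD; have := expR_ge1Dx (- (2 * p * (p * k%:R))).
have := mul_expRN_le1 (p * k%:R); have := expR_gt0 (- (p * k%:R)).
set a := expR (- (p * k%:R)); set b := expR (- (2 * p * _)); set x := p * k%:R.
move=> a0 xa xb ab.
have : a * (1 - 2 * p * x) <= a * b by rewrite ler_wpM2l // ?ltW.
have : 2 * p * (x * a) <= 2 * p * 1 by rewrite ler_wpM2l // mulr_ge0.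
by lra.
Qed.

(** For x < 1/2 the left side is at most 1, and the right side exceeds 1. On [1/2, oo) the slope mu
    exp(- mu y) is at most 1 / y <= 2, whatever the size of mu. *)
Lemma expR_scale_dist mu x : 0 <= mu -> 0 <= x ->
  `|expR (- (mu * x)) - expR (- mu)| <= 2 * `|x - 1|.
Proof.
move=> mu0 x0.
have E1 y : 0 <= y -> expR (- y) <= 1 by move=> y0; rewrite expR_le1 oppr_le0.
have [x2|x2] := ltP x (1 / 2).
  have := E1 _ mu0; have := E1 _ (mulr_ge0 mu0 x0).
  have := expR_gt0 (- mu); have := expR_gt0 (- (mu * x)) => *.
  by rewrite ler_norml (ler0_norm (x := x - 1)); [apply/andP; split; lra|lra].
have key y z : 1 / 2 <= y -> y <= z ->
    `|expR (- (mu * y)) - expR (- (mu * z))| <= 2 * (z - y).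
  move=> y2 yz.
  have -> : - (mu * z) = - (mu * y) + - (mu * (z - y)) by ring.
  rewrite expRD; set a := expR (- (mu * y)); set b := expR _.
  have a0 : 0 < a by exact: expR_gt0.
  have b1 : b <= 1 by apply: E1; rewrite mulr_ge0 // subr_ge0.
  have b2 : 1 - mu * (z - y) <= b by exact: expR_ge1Dx.
  have ma : mu * a <= 2.
    have : mu * y * a <= 1 by exact: mul_expRN_le1.
    have : 0 <= (y - 1 / 2) * (mu * a) by rewrite mulr_ge0 ?subr_ge0 // mulr_ge0 // ltW.
    by lra.
  rewrite ger0_norm; last by rewrite subr_ge0 ler_piMr // ltW.
  have : a * (1 - mu * (z - y)) <= a * b by rewrite ler_wpM2l // ltW.
  have : (mu * a) * (z - y) <= 2 * (z - y) by rewrite ler_wpM2r // subr_ge0.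
  by lra.
have [x1|x1] := leP x 1.
  by have := key x 1 x2 x1; rewrite mulr1 [`|x - 1|]distrC [`|1 - x|]ger0_norm ?subr_ge0.
have := key 1 x _ (ltW x1); rewrite mulr1 [`|x - 1|]ger0_norm ?subr_ge0; last exact: ltW.
by rewrite distrC; apply; lra.
Qed.

Lemma expR_scale_sqr mu x : 0 <= mu -> 0 <= x ->
  (expR (- (mu * x)) - expR (- mu)) ^+ 2 <= 4 * (x - 1) ^+ 2.
Proof.
move=> mu0 x0; have h := expR_scale_dist mu0 x0.
rewrite -[leLHS]real_normK ?num_real // -[X in 4 * X]real_normK ?num_real //.
have -> : 4 * `|x - 1| ^+ 2 = (2 * `|x - 1|) ^+ 2 by ring.
by rewrite lerXn2r ?nnegrE // mulr_ge0.
Qed.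

End ElementaryInequalities.

(** * Moment bounds for spheres and balls, for m = n q at least 2 *)

Section Moments.
Context (R : realType) (n : nat) (q : R) (r : 'I_n).
Hypothesis q01 : 0 <= q <= 1.
Let m : R := n%:R * q.
Hypothesis m2 : 2 <= m.
Implicit Types (E : {set {set 'I_n}}) (k : nat).
Local Notation Ex := (@er_exp R n q).
Let s E k : R := shsize R r E k.
Let b E k : R := basize R r E k.
Let u E k : R := outside R r E k.
Let rho E k : R := avoid q r E k.

Let q0 : 0 <= q. Proof. by case/andP: q01. Qed.
Let m0 : 0 < m. Proof. by apply: lt_le_trans m2. Qed.
Let n0 : 0 < n%:R :> R.
Proof. by rewrite ltr0n; apply: leq_ltn_trans (ltn_ord r). Qed.
Let s0 E k : 0 <= s E k. Proof. exact: ler0n. Qed.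
Let b0 E k : 0 <= b E k. Proof. exact: ler0n. Qed.
Let u0 E k : 0 <= u E k. Proof. exact: ler0n. Qed.
Let uE E k : u E k = n%:R - b E k. Proof. exact: outsideE. Qed.
Let un E k : u E k <= n%:R. Proof. by rewrite uE lerBlDr lerDl b0. Qed.
Let bn E k : b E k <= n%:R. Proof. by have := u0 E k; rewrite uE subr_ge0. Qed.
Let bS E k : b E k.+1 = b E k + s E k.+1.
Proof. by rewrite /b /s /basize /shsize card_ballS natrD. Qed.

Let rho0 E k : 0 <= rho E k.
Proof. by rewrite exprn_ge0 // subr_ge0; case/andP: q01. Qed.
Let rho1 E k : rho E k <= 1.
Proof. by rewrite exprn_ile1 // ?subr_ge0 ?lerBlDr ?lerDl //; case/andP: q01. Qed.

Let hit_le E k : u E k * (1 - rho E k) <= m * s E k.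
Proof.
rewrite /m -mulrA; apply: ler_pM => //; first by rewrite subr_ge0.
exact: bernoulli_le.
Qed.

Let hit_ge0 E k : 0 <= u E k * (1 - rho E k).
Proof. by rewrite mulr_ge0 // subr_ge0. Qed.

(** Two losses against m S_k: the quadratic one covers vertices with several neighbours in the
    sphere, the one with [b E k] covers vertices already explored. *)
Let hit_ge E k :
  m * s E k - (m * q * s E k ^+ 2 + q * (s E k * b E k)) <= u E k * (1 - rho E k).
Proof.
have h : q * s E k - (q * s E k) ^+ 2 <= 1 - rho E k := bernoulli_ge _ q01.
have : u E k * (q * s E k - (q * s E k) ^+ 2) <= u E k * (1 - rho E k).
  by rewrite ler_wpM2l.
have : 0 <= b E k * (q * s E k) ^+ 2 by rewrite mulr_ge0 // sqr_ge0.
by rewrite {1}uE /m; lra.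
Qed.

Lemma shell0 E : shsize R r E 0 = 1. Proof. by rewrite /shsize cards1. Qed.
Lemma gball0 E : basize R r E 0 = 1. Proof. by rewrite /basize cards1. Qed.

Let exp_hit k : Ex (fun E => s E k.+1) = Ex (fun E => u E k * (1 - rho E k)).
Proof.
have := er_exp_shell q r (fun=> 1) k.
rewrite (eq_er_exp _ (Y := fun E => s E k.+1)); last by move=> E; rewrite mul1r.
by move=> ->; apply: eq_er_exp => E; rewrite mul1r.
Qed.

Lemma exp_shell_le k : Ex (fun E => s E k) <= m ^+ k.
Proof.
elim: k => [|k IH].
  by rewrite expr0 (eq_er_exp _ (Y := fun=> 1)) ?er_exp_cst // => E; exact: shell0.
rewrite exp_hit exprS.
apply: le_trans (_ : Ex (fun E => m * s E k) <= _); first exact: ler_er_exp.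
by rewrite er_expZ ler_wpM2l // ltW.
Qed.

(** The subtracted term makes the induction close: with x = m^k, the recursion adds m x to m^2 times
    the old bound, and the slack left over is x (m - 2). *)
Lemma exp_shell_sqr_le k :
  Ex (fun E => s E k ^+ 2) <= (1 + 2 / m) * (m ^+ k) ^+ 2 - 2 / m * m ^+ k.
Proof.
elim: k => [|k IH].
  rewrite expr0 expr1n !mulr1 addrK.
  by rewrite (eq_er_exp _ (Y := fun=> 1)) ?er_exp_cst // => E; rewrite [s E 0]shell0 expr1n.
rewrite er_exp_shell_sqr.
apply: le_trans (_ : Ex (fun E => m * s E k + m ^+ 2 * s E k ^+ 2) <= _).
  apply: ler_er_exp => // E; apply: lerD.
    apply: le_trans (hit_le E k).
    rewrite ler_wpM2l // ler_piMl // subr_ge0 //; exact: rho1.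
  rewrite -exprMn; apply: lerXn2r (hit_le E k); rewrite nnegrE; first exact: hit_ge0.
  by rewrite mulr_ge0 // ltW.
rewrite er_expD !er_expZ [m ^+ k.+1]exprS.
have h1 := exp_shell_le k.
set x := m ^+ k in IH h1 *.
have x0 : 0 < x by exact: exprn_gt0.
have h2 : m * er_exp q (fun E => s E k) <= m * x by rewrite ler_wpM2l // ltW.
have h3 : m ^+ 2 * er_exp q (fun E => s E k ^+ 2) <=
   m ^+ 2 * ((1 + 2 / m) * x ^+ 2 - 2 / m * x) by rewrite ler_wpM2l // sqr_ge0.
apply: le_trans (lerD h2 h3) _.
rewrite -subr_ge0.
have -> : (1 + 2 / m) * (m * x) ^+ 2 - 2 / m * (m * x) -
   (m * x + m ^+ 2 * ((1 + 2 / m) * x ^+ 2 - 2 / m * x)) = x * (m - 2).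
  by field; rewrite gt_eqF.
by rewrite mulr_ge0 ?subr_ge0 // ltW.
Qed.

Lemma exp_shell_sqr_le2 k : Ex (fun E => s E k ^+ 2) <= 2 * (m ^+ k) ^+ 2.
Proof.
apply: le_trans (exp_shell_sqr_le k) _.
have x0 : 0 < m ^+ k by exact: exprn_gt0.
have im : 0 <= 2 / m <= 1 by rewrite divr_ge0 ?(ltW m0) //= ler_pdivrMr // mul1r.
case/andP: im => i0 i1; have : 0 <= (1 - 2 / m) * (m ^+ k) ^+ 2.
  by rewrite mulr_ge0 ?sqr_ge0 // subr_ge0.
have : 0 <= 2 / m * m ^+ k by rewrite mulr_ge0 // ltW.
by lra.
Qed.

Lemma exp_ball_le k : Ex (fun E => b E k) <= 2 * m ^+ k.
Proof.
elim: k => [|k IH].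
  rewrite expr0 (eq_er_exp _ (Y := fun=> 1)) ?er_exp_cst; first by lra.
  by move=> E; exact: gball0.
rewrite (eq_er_exp _ (Y := fun E => b E k + s E k.+1)); last by move=> E; exact: bS.
rewrite er_expD; apply: le_trans (lerD IH (exp_shell_le k.+1)) _.
have : 0 <= (m - 2) * m ^+ k by rewrite mulr_ge0 ?subr_ge0 // exprn_ge0 // ltW.
by rewrite exprS; lra.
Qed.

(** The product at k + 1 is S_(k+1)^2 + B_k S_(k+1). The first term costs 2 m^(2k+2); conditioning
    bounds the second by m S_k B_k on average, and 4 m <= 2 m^2. *)
Lemma exp_shell_ball_le k : Ex (fun E => s E k * b E k) <= 4 * (m ^+ k) ^+ 2.
Proof.
elim: k => [|k IH].
  rewrite expr0 (eq_er_exp _ (Y := fun=> 1)) ?er_exp_cst; first by lra.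
  by move=> E; rewrite [s E 0]shell0 [b E 0]gball0 mulr1.
rewrite (eq_er_exp _ (Y := fun E => s E k.+1 ^+ 2 + b E k * s E k.+1)); last first.
  by move=> E; rewrite bS; ring.
rewrite er_expD.
have h := er_exp_shell q r (fun x => #|x.1|%:R) k; rewrite /= in h.
have h1 : er_exp q (fun E => b E k * s E k.+1) <= 2 * (m ^+ k.+1) ^+ 2.
  rewrite [leLHS]h.
  apply: le_trans (_ : Ex (fun E => m * (s E k * b E k)) <= _).
    apply: ler_er_exp => // E; rewrite -/(gball r E k) -/(basize R r E k).
    by rewrite [leRHS]mulrA [leRHS]mulrC; apply: ler_wpM2l (hit_le E k).
  rewrite er_expZ; apply: le_trans (_ : m * (4 * (m ^+ k) ^+ 2) <= _).
    by rewrite ler_wpM2l // ltW.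
  have : 0 <= (m - 2) * m * (m ^+ k) ^+ 2.
    by rewrite mulr_ge0 ?sqr_ge0 // mulr_ge0 ?subr_ge0 // ltW.
  by rewrite [m ^+ k.+1]exprS; lra.
by have := exp_shell_sqr_le2 k.+1; lra.
Qed.

(** With x = m^k, one step multiplies the old error 8 x^2 / n by m and adds (2 m^2 + 4 m) x^2 / n;
    the total stays below 8 (m x)^2 / n because 6 m (m - 2) >= 0. *)
Lemma exp_shell_ge k : m ^+ k - 8 * (m ^+ k) ^+ 2 / n%:R <= Ex (fun E => s E k).
Proof.
elim: k => [|k IH].
  rewrite expr0 (eq_er_exp _ (Y := fun=> 1)) ?er_exp_cst; last by move=> E; exact: shell0.
  by rewrite lerBlDr lerDl divr_ge0 // ?mulr_ge0 // ltW.
rewrite exp_hit.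
apply: le_trans (_ : Ex (fun E =>
    m * s E k - (m * q * s E k ^+ 2 + q * (s E k * b E k))) <= _); last first.
  exact: ler_er_exp.
rewrite er_expB er_expD !er_expZ.
have h1 := exp_shell_sqr_le2 k; have h2 := exp_shell_ball_le k.
have a1 : m * (m ^+ k - 8 * (m ^+ k) ^+ 2 / n%:R) <= m * er_exp q (fun E => s E k).
  by rewrite ler_wpM2l // ltW.
have a2 : m * q * er_exp q (fun E => s E k ^+ 2) <= m * q * (2 * (m ^+ k) ^+ 2).
  by rewrite ler_wpM2l // mulr_ge0 // ltW.
have a3 : q * er_exp q (fun E => s E k * b E k) <= q * (4 * (m ^+ k) ^+ 2).
  by rewrite ler_wpM2l.
apply: le_trans (lerB a1 (lerD a2 a3)).
have qE : q = m / n%:R by rewrite /m mulrAC divff ?mul1r // gt_eqF.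
rewrite -subr_ge0 [X in m * X * _]qE [X in _ + X * _]qE [m ^+ k.+1]exprS.
set x := m ^+ k; have -> : m * (x - 8 * x ^+ 2 / n%:R) -
   (m * (m / n%:R) * (2 * x ^+ 2) + m / n%:R * (4 * x ^+ 2)) -
   (m * x - 8 * (m * x) ^+ 2 / n%:R) =
   (x ^+ 2 / n%:R) * (6 * m ^+ 2 - 12 * m) by field; rewrite gt_eqF.
rewrite mulr_ge0 // ?divr_ge0 ?sqr_ge0 // ?(ltW n0) //.
have -> : 6 * m ^+ 2 - 12 * m = 6 * m * (m - 2) by ring.
by rewrite mulr_ge0 ?subr_ge0 // mulr_ge0 // ltW.
Qed.

(** Expanding the square, the upper bound on the second moment and the lower bound on the mean give
    (1 + 2/m) - 2 (1 - 8 m^k / n) + 1. *)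
Lemma exp_shell_rel_dev k :
  Ex (fun E => (s E k / m ^+ k - 1) ^+ 2) <= 2 / m + 16 * (m ^+ k / n%:R).
Proof.
set x := m ^+ k; have x0 : 0 < x by exact: exprn_gt0.
rewrite (eq_er_exp _ (Y := fun E =>
    x ^- 2 * s E k ^+ 2 - 2 / x * s E k + 1)); last first.
  by move=> E; rewrite /x; field; rewrite gt_eqF.
rewrite er_expD er_expB !er_expZ er_exp_cst.
have h1 := exp_shell_sqr_le k; have h2 := exp_shell_ge k; rewrite -/x in h1 h2.
have a1 : x ^- 2 * er_exp q (fun E => s E k ^+ 2) <= x ^- 2 * ((1 + 2 / m) * x ^+ 2).
  rewrite ler_wpM2l ?invr_ge0 ?sqr_ge0 //; apply: le_trans h1 _.
  by rewrite lerBlDr lerDl mulr_ge0 ?divr_ge0 // ltW.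
have a2 : 2 / x * (x - 8 * x ^+ 2 / n%:R) <= 2 / x * er_exp q (fun E => s E k).
  by rewrite ler_wpM2l // divr_ge0 // ltW.
apply: le_trans (lerD (lerB a1 a2) (lexx 1)) _.
rewrite le_eqVlt; apply/orP; left; apply/eqP; field.
by rewrite !gt_eqF.
Qed.

Let dev E k := s E k.+1 - u E k * (1 - rho E k).

Lemma exp_dev_le k : Ex (fun E => dev E k ^+ 2) <= n%:R.
Proof.
rewrite er_exp_shell_var -[leRHS](er_exp_cst n q); apply: ler_er_exp => // E.
rewrite -[leRHS]mulr1; apply: ler_pM => //.
  by rewrite mulr_ge0 // subr_ge0; exact: rho1.
by apply: mulr_ile1; rewrite ?subr_ge0 ?lerBlDr ?lerDl //; exact: rho1.
Qed.

Lemma exp_shell_fraction k : q <= 1 / 2 ->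
  Ex (fun E => (s E k.+1 / n%:R - (1 - expR (- (q * m ^+ k)))) ^+ 2) <=
  4 / n%:R + 16 * q ^+ 2 + 32 / m + 264 * (m ^+ k / n%:R).
Proof.
move=> q2; set x := m ^+ k; have x0 : 0 < x by exact: exprn_gt0.
pose Z E := s E k / x.
apply: le_trans (_ : Ex (fun E => 4 / n%:R ^+ 2 * dev E k ^+ 2 + 4 / n%:R * b E k
    + 16 * (Z E - 1) ^+ 2 + 16 * q ^+ 2) <= _).
  apply: ler_er_exp => // E.
  set lam := expR _; set e := expR (- (q * s E k)).
  have h1 : 0 <= e - rho E k by rewrite subr_ge0; exact: onem_expR_le.
  have h2 : e - rho E k <= 2 * q by apply: onem_expR_ge; rewrite q0.
  have h3 : (e - lam) ^+ 2 <= 4 * (Z E - 1) ^+ 2.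
    have -> : e = expR (- (q * x * Z E)).
      by congr (expR (- _)); rewrite /Z; field; rewrite gt_eqF.
    apply: expR_scale_sqr; last by rewrite divr_ge0 // ltW.
    by rewrite mulr_ge0 // ltW.
  have h4 : (b E k / n%:R * (1 - rho E k)) ^+ 2 <= b E k / n%:R.
    have bn01 : 0 <= b E k / n%:R <= 1.
      by rewrite divr_ge0 ?(ltW n0) //= ler_pdivrMr // mul1r.
    have := rho0 E k; have := rho1 E k; case/andP: bn01.
    set y := b E k / n%:R; set z := rho E k => y0 y1 z1 z0.
    have a0 : 0 <= y * (1 - z) by rewrite mulr_ge0 // subr_ge0.
    have a1 : y * (1 - z) <= y by rewrite ler_piMr // lerBlDr lerDl.
    by rewrite expr2; apply: le_trans (_ : y * 1 <= y); [apply: ler_pM => //; lra|rewrite mulr1].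
  (* Four errors: the fluctuation of the step, the vertices already in the ball, the passage from (1
     - q)^S to exp(- q S), and that from S to m^k. *)
  have -> : s E k.+1 / n%:R - (1 - lam) =
      dev E k / n%:R - b E k / n%:R * (1 - rho E k) + (e - rho E k) - (e - lam).
    by rewrite /dev uE; field; rewrite gt_eqF.
  have h5 : (e - rho E k) ^+ 2 <= 4 * q ^+ 2.
    have -> : 4 * q ^+ 2 = (2 * q) ^+ 2 by ring.
    by rewrite lerXn2r ?nnegrE ?mulr_ge0.
  have -> : 4 / n%:R ^+ 2 * dev E k ^+ 2 = 4 * (dev E k / n%:R) ^+ 2.
    by field; rewrite gt_eqF.
  have -> : 4 / n%:R * b E k = 4 * (b E k / n%:R) by field; rewrite gt_eqF.
  move: h3 h4 h5; set x1 := dev E k / _; set x2 := _ * (1 - rho E k).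
  set x3 := e - rho E k; set x4 := e - lam => h3 h4 h5.
  have : (x1 - x2 + x3 - x4) ^+ 2 <= 4 * (x1 ^+ 2 + x2 ^+ 2 + x3 ^+ 2 + x4 ^+ 2).
    (* The difference of the two sides is the sum of these six squares. *)
    have := sqr_ge0 (x1 + x2); have := sqr_ge0 (x1 - x3); have := sqr_ge0 (x1 + x4).
    have := sqr_ge0 (x2 + x3); have := sqr_ge0 (x2 - x4); have := sqr_ge0 (x3 + x4).
    by lra.
  by lra.
(* The coefficient 264 is 8 from the ball plus 16 times 16 from the relative deviation. *)
rewrite 3!er_expD er_exp_cst !er_expZ.
have h1 := exp_dev_le k; have h2 := exp_ball_le k.
have h3 := exp_shell_rel_dev k; rewrite -/x in h1 h2 h3.
have a1 : 4 / n%:R ^+ 2 * er_exp q (fun E => dev E k ^+ 2) <= 4 / n%:R.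
  rewrite (_ : 4 / n%:R = 4 / n%:R ^+ 2 * n%:R :> R); last by field; rewrite gt_eqF.
  by rewrite ler_wpM2l // divr_ge0 // sqr_ge0.
have a2 : 4 / n%:R * er_exp q (fun E => b E k) <= 8 * (x / n%:R).
  rewrite (_ : 8 * (x / n%:R) = 4 / n%:R * (2 * x)); last by field; rewrite gt_eqF.
  by rewrite ler_wpM2l // divr_ge0 // ltW.
by move: h3; rewrite -/(Z _); lra.
Qed.

(** Here [g] bounds the conditional mean of S_(k+1) from below when S_k >= m^k / 2 and the ball
    holds at most half of the vertices. If moreover the step falls short of its mean by at most g /
    2, then S_(k+1) >= g / 2 and a vertex is missed at step k + 2 with probability at most exp(- q g
    / 2). *)
Lemma exp_far_fraction k (g : R) : 0 < g ->
  g <= n%:R / 2 * (1 - expR (- (q * m ^+ k / 2))) ->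
  Ex (fun E => (b E k + u E k.+2) / n%:R) <=
  expR (- (q * g / 2)) + 8 / m + 70 * (m ^+ k / n%:R) + 4 * n%:R / g ^+ 2.
Proof.
set x := m ^+ k; have x0 : 0 < x by exact: exprn_gt0.
move=> g0 gle; pose Z E := s E k / x.
have hu : Ex (fun E => u E k.+2) = Ex (fun E => u E k.+1 * rho E k.+1).
  have := er_exp_outside q r (fun=> 1) k.+1.
  rewrite (eq_er_exp _ (Y := fun E => u E k.+2)); last by move=> E; rewrite mul1r.
  by move=> ->; apply: eq_er_exp => E; rewrite mul1r.
have -> : Ex (fun E => (b E k + u E k.+2) / n%:R) =
    n%:R^-1 * (Ex (fun E => b E k) + Ex (fun E => u E k.+1 * rho E k.+1)).
  by rewrite -hu -er_expD -er_expZ; apply: eq_er_exp => E; rewrite mulrC.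
have h : Ex (fun E => u E k.+1 * rho E k.+1) <=
  Ex (fun E => n%:R * (expR (- (q * g / 2)) + 4 * (Z E - 1) ^+ 2 + 2 / n%:R * b E k
      + 4 / g ^+ 2 * dev E k ^+ 2)).
  apply: ler_er_exp => // E; apply: ler_pM => //.
  apply: le_trans (_ : expR (- (q * s E k.+1)) <= _); first exact: onem_expR_le.
  have e1 : expR (- (q * s E k.+1)) <= 1.
    by rewrite expR_le1 oppr_le0 mulr_ge0.
  have t1 := expR_ge0 (- (q * g / 2)); have t2 : 0 <= 4 * (Z E - 1) ^+ 2.
    by rewrite mulr_ge0 // sqr_ge0.
  have t3 : 0 <= 2 / n%:R * b E k by rewrite mulr_ge0 // divr_ge0 // ltW.
  have t4 : 0 <= 4 / g ^+ 2 * dev E k ^+ 2.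
    by rewrite mulr_ge0 ?sqr_ge0 // divr_ge0 ?sqr_ge0.
  (* In each of the three bad cases one of the added terms is at least 1, which already dominates
     the exponential. *)
  have [Z2|Z2] := ltP (Z E) (1 / 2).
    have : 0 <= (1 / 2 - Z E) * (3 / 2 - Z E) by rewrite mulr_ge0; lra.
    by lra.
  have [b2|b2] := ltP (n%:R / 2) (b E k).
    have : 1 <= 2 / n%:R * b E k by rewrite mulrAC ler_pdivlMr //; lra.
    by lra.
  have [d2|d2] := ltP (dev E k) (- (g / 2)).
    have : 1 <= 4 / g ^+ 2 * dev E k ^+ 2.
      rewrite mulrAC ler_pdivlMr ?exprn_gt0 //.
      have : 0 <= (- (g / 2) - dev E k) * (g / 2 - dev E k) by rewrite mulr_ge0; lra.
      by lra.
    by lra.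
  have : g <= u E k * (1 - rho E k).
    apply: le_trans gle _; apply: ler_pM => //.
    - by rewrite subr_ge0 expR_le1 oppr_le0 divr_ge0 // mulr_ge0 // ltW.
    - by rewrite uE; lra.
    rewrite lerD2l lerN2; apply: le_trans (onem_expR_le _ q01) _.
    rewrite ler_expR lerN2 -/(shsize R r E k) -/(s E k) -mulrA ler_wpM2l //.
    by move: Z2; rewrite /Z ler_pdivlMr //; lra.
  have hs : dev E k + u E k * (1 - rho E k) = s E k.+1 by rewrite /dev subrK.
  move=> hg; have sg : g / 2 <= s E k.+1 by rewrite -hs; lra.
  have : expR (- (q * s E k.+1)) <= expR (- (q * g / 2)).
    by rewrite ler_expR lerN2 -mulrA ler_wpM2l.
  by lra.
move: h; rewrite er_expZ 3!er_expD er_exp_cst !er_expZ.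
have h1 := exp_dev_le k; have h2 := exp_ball_le k.
have h3 := exp_shell_rel_dev k; rewrite -/x in h1 h2 h3.
have a1 : 4 / g ^+ 2 * er_exp q (fun E => dev E k ^+ 2) <= 4 / g ^+ 2 * n%:R.
  by rewrite ler_wpM2l // divr_ge0 // sqr_ge0.
have a2 : 2 / n%:R * er_exp q (fun E => b E k) <= 2 / n%:R * (2 * x).
  by rewrite ler_wpM2l // divr_ge0 // ltW.
have a3 : n%:R^-1 * er_exp q (fun E => b E k) <= n%:R^-1 * (2 * x).
  by rewrite ler_wpM2l // invr_ge0 ltW.
move=> h; rewrite mulrDr [X in _ + X]mulrC.
have i0 : 0 <= n%:R^-1 :> R by rewrite invr_ge0 ltW.
have a4 := ler_wpM2r i0 h.
apply: le_trans (lerD a3 a4) _.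
rewrite [n%:R * (_ + _)]mulrC mulfK ?gt_eqF //.
rewrite -/(Z _) in h3.
by move: (er_exp q _) (er_exp q _) (er_exp q _) (expR _) h3 a1 a2 => x1 x2 x3 y h3 a1 a2; lra.
Qed.

End Moments.

Lemma er_probC (R : realType) n (q : R) (A : pred {set {set 'I_n}}) :
  er_prob q A = 1 - er_prob q (predC A).
Proof.
rewrite !er_probE -[X in X - _](er_exp_cst n q) -er_expB; apply: eq_er_exp => E.
by rewrite /=; case: (A E); rewrite ?subr0 ?subrr.
Qed.

Lemma er_prob_sub (R : realType) n (q : R) (A B : pred {set {set 'I_n}}) :
  0 <= q <= 1 -> (forall E, A E -> B E) -> er_prob q A <= er_prob q B.
Proof.
move=> q01 AB; rewrite !er_probE; apply: ler_er_exp => // E.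
by rewrite ler_nat; case: (A E) (AB E) => // ->.
Qed.

(** * Concentration at a fixed n, with k + 1 in the role of d_n^* and [l2] in that of (log log
    n)^2 *)

Section Concentration.
Context (R : realType) (n : nat) (q : R) (k : nat) (l2 : R).
Let m : R := n%:R * q.
Hypothesis q12 : 0 <= q <= 1 / 2.
Hypothesis m2 : 2 <= m.
Hypothesis l2_ge1 : 1 <= l2.
Hypothesis mk_lt : m ^+ k < n%:R / l2.
Hypothesis mk_ge : n%:R / l2 <= m ^+ k.+1.
Implicit Types E : {set {set 'I_n}}.

Let n0 : (0 < n)%N.
Proof. by move: m2; rewrite /m; case: (n) => // ; rewrite mul0r; lra. Qed.
Let nR0 : 0 < n%:R :> R. Proof. by rewrite ltr0n. Qed.
Let q01 : 0 <= q <= 1. Proof. by case/andP: q12 => a b; apply/andP; split; lra. Qed.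
Let l0 : 0 < l2. Proof. exact: lt_le_trans l2_ge1. Qed.
Let m0 : 0 < m. Proof. exact: lt_le_trans m2. Qed.
Let r : 'I_n := Ordinal n0.

Let near_frac E : R := (Ndist E k.+1%:Z)%:R / n%:R.
Let far_frac E : R :=
  #|~: (sphere E k.+1%:Z :|: sphere E k.+2%:Z)%SET|%:R / n%:R.
Let lam : R := expR (- (m ^+ k.+1 / n%:R)).

Let mu_ge : l2^-1 <= q * m ^+ k.
Proof.
have -> : q * m ^+ k = m ^+ k.+1 / n%:R.
  by rewrite exprS {2}/m; field; rewrite gt_eqF.
by rewrite ler_pdivlMr // mulrC.
Qed.

Let mk_le : m ^+ k / n%:R <= l2^-1.
Proof. by rewrite ler_pdivrMr // mulrC ltW. Qed.

Let lamE : lam = expR (- (q * m ^+ k)).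
Proof. by congr (expR (- _)); rewrite exprS {1}/m; field; rewrite gt_eqF. Qed.

Definition near_bound : R := 4 / n%:R + 16 * q ^+ 2 + 32 / m + 264 / l2.
Definition far_bound : R := 16 * l2 / m + 8 / m + 70 / l2 + 256 * l2 ^+ 2 / n%:R.

Let exp_near : er_exp q (fun E => (near_frac E - (1 - lam)) ^+ 2) <= near_bound.
Proof.
rewrite lamE (eq_er_exp _ (Y := fun E =>
    (shsize R r E k.+1 / n%:R - (1 - expR (- (q * m ^+ k)))) ^+ 2)); last first.
  by move=> E; rewrite /near_frac /Ndist (sphereE (r := r)).
have q2 : q <= 1 / 2 by case/andP: q12.
apply: le_trans (exp_shell_fraction r q01 m2 k q2) _.
by rewrite /near_bound -/m lerD2l ler_wpM2l.
Qed.

Let far_fracE E :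
  far_frac E = (basize R r E k + outside R r E k.+2) / n%:R.
Proof.
rewrite /far_frac (card_outside_two_spheres (r := r)) // natrD.
congr ((_ + _%:R) / _).
by rewrite [in RHS]cardsCs finset.setCK card_ord.
Qed.

Let exp_far : er_exp q far_frac <= far_bound.
Proof.
rewrite (eq_er_exp _ far_fracE).
(* As q m^k / 2 >= y = 1 / (2 l2) and 1 - exp(- y) >= y / 2, the lower bound required of the mean is
   at least n / 2 times 1 / (4 l2). *)
pose g := n%:R / (8 * l2).
have g0 : 0 < g by rewrite divr_gt0 // mulr_gt0.
have gle : g <= n%:R / 2 * (1 - expR (- (q * m ^+ k / 2))).
  have -> : g = n%:R / 2 * (l2^-1 / 4) by rewrite /g; field; rewrite gt_eqF.
  rewrite ler_wpM2l ?divr_ge0 ?(ltW nR0) //.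
  pose y := l2^-1 / 2; have y0 : 0 < y by rewrite divr_gt0 // invr_gt0.
  have y1 : y <= 1 by have := invf_le1 l0; rewrite l2_ge1 /y; lra.
  have : expR (- (q * m ^+ k / 2)) <= expR (- y).
    by rewrite ler_expR lerN2 ler_wpM2r // invr_ge0.
  have : expR (- y) <= 1 - y / 2.
    rewrite expRN invf_ple ?posrE ?expR_gt0 //; last by lra.
    apply: le_trans (expR_ge1Dx y); rewrite -div1r ler_pdivrMr; last by lra.
    by nra.
  have -> : l2^-1 / 4 = y / 2 by rewrite /y; field; rewrite gt_eqF.
  by lra.
apply: le_trans (exp_far_fraction r q01 m2 g0 gle) _; rewrite -/m /far_bound.
(* The crude bound exp(- x) <= 1 / x suffices, since m is of order log n and [l2] is much
   smaller. *)
have a1 : expR (- (q * g / 2)) <= 16 * l2 / m.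
  have -> : q * g / 2 = m / (16 * l2) by rewrite /g /m; field; rewrite gt_eqF.
  have -> : 16 * l2 / m = (m / (16 * l2))^-1 by rewrite invf_div.
  by apply: expRN_leV; rewrite divr_gt0 // mulr_gt0.
have -> : 4 * n%:R / g ^+ 2 = 256 * l2 ^+ 2 / n%:R.
  by rewrite /g; field; rewrite !gt_eqF.
by move: mk_le; lra.
Qed.

Lemma near_frac_concentration t : 0 < t ->
  er_prob q (fun E => t < `|near_frac E - (1 - lam)|) <= near_bound / t ^+ 2.
Proof.
move=> t0.
apply: le_trans (er_markov (X := fun E => (near_frac E - (1 - lam)) ^+ 2)
  (t := t ^+ 2) q01 _ _ _) _.
- exact: exprn_gt0.
- by move=> E; exact: sqr_ge0.
- move=> E tE; rewrite -[leRHS]real_normK ?num_real //.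
  by rewrite lerXn2r ?nnegrE // ltW.
by rewrite ler_wpM2r // invr_ge0 sqr_ge0.
Qed.

Lemma far_frac_concentration t : 0 < t ->
  er_prob q (fun E => t < far_frac E) <= far_bound / t.
Proof.
move=> t0; apply: le_trans (er_markov (X := far_frac) q01 t0 _ _) _.
- by move=> E; rewrite divr_ge0.
- by move=> E /ltW.
by rewrite ler_wpM2r // invr_ge0 ltW.
Qed.

(** The two spheres and the remaining vertices partition the graph, so a deviation above t here
    forces one above t / 2 on the first sphere or a remainder of at least t / 2. In either case [X]
    is at least 1. *)
Lemma next_frac_concentration t : 0 < t ->
  er_prob q (fun E => t < `|(Ndist E k.+2%:Z)%:R / n%:R - lam|) <=
  4 / t ^+ 2 * near_bound + 2 / t * far_bound.
Proof.
move=> t0; pose X E := 4 / t ^+ 2 * (near_frac E - (1 - lam)) ^+ 2 + 2 / t * far_frac E.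
have F0 E : 0 <= far_frac E by rewrite divr_ge0.
have c1 : 0 <= 4 / t ^+ 2 by rewrite divr_ge0 // sqr_ge0.
have c2 : 0 <= 2 / t by rewrite divr_ge0 // ltW.
apply: le_trans (er_markov (X := X) q01 ltr01 _ _) _.
- by move=> E; rewrite addr_ge0 // mulr_ge0 // sqr_ge0.
- move=> E.
  have -> : (Ndist E k.+2%:Z)%:R / n%:R - lam =
      - (near_frac E - (1 - lam)) - far_frac E.
    rewrite far_fracE /near_frac /Ndist !(sphereE (r := r)) //.
    have h1 := shsizeS R r E k.+1; have h2 := shsizeS R r E k.
    rewrite -/(shsize R r E k.+1) -/(shsize R r E k.+2) h1 h2 (outsideE R r E k).
    by field; rewrite gt_eqF.
  rewrite /X; set x := near_frac E - _; set y := far_frac E => h.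
  have y0 : 0 <= y := F0 E.
  have : t < `|x| + y.
    by apply: lt_le_trans h _; rewrite -opprD normrN -{2}(ger0_norm y0) ler_normD.
  have [yt _|yt tx] := leP (t / 2) y.
    have : 1 <= 2 / t * y by rewrite mulrAC ler_pdivlMr //; lra.
    have : 0 <= 4 / t ^+ 2 * x ^+ 2 by rewrite mulr_ge0 // sqr_ge0.
    by lra.
  have : 1 <= 4 / t ^+ 2 * x ^+ 2.
    rewrite mulrAC ler_pdivlMr ?exprn_gt0 // mul1r -[x ^+ 2]real_normK ?num_real //.
    have -> : 4 * `|x| ^+ 2 = (2 * `|x|) ^+ 2 by ring.
    by rewrite lerXn2r ?nnegrE ?mulr_ge0 //; lra.
  have : 0 <= 2 / t * y by rewrite mulr_ge0.
  by lra.
rewrite divr1 er_expD !er_expZ; apply: lerD; first by rewrite ler_wpM2l.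
by rewrite ler_wpM2l.
Qed.

End Concentration.

Local Open Scope classical_set_scope.

(** * The minimum defining d_n^*, and eventual bounds on alpha *)

Section Threshold.
Context (R : realType).

(** Powers with exponent at most 0 do not exceed 1 < x, so the least integer exponent is a positive
    natural number; one exists since m^j >= 1 + (m - 1) j. *)
Lemma least_exponent (m x : R) : 1 < m -> 1 < x ->
  exists k : nat, [/\ m ^+ k < x, x <= m ^+ k.+1 &
    forall d : int, x <= m ^ d -> k.+1%:Z <= d].
Proof.
move=> m1 x1; have m0 : 0 < m by exact: lt_trans m1.
have ex : exists k, x <= m ^+ k.
  have hb j : 1 + (m - 1) * j%:R <= m ^+ j.
    elim: j => [|j IH]; first by rewrite mulr0 addr0 expr0.
    rewrite exprS -natr1; have : m * (1 + (m - 1) * j%:R) <= m * m ^+ j.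
      by rewrite ler_wpM2l // ltW.
    have : 0 <= (m - 1) * ((m - 1) * j%:R) by rewrite !mulr_ge0 //; lra.
    by lra.
  exists (Num.bound (x / (m - 1))); apply: le_trans (hb _).
  have : x / (m - 1) < (Num.bound (x / (m - 1)))%:R.
    by apply: archi_boundP; rewrite divr_ge0 //; lra.
  by rewrite ltr_pdivrMr; lra.
case: (ex_minnP ex) => -[|k] kx kmin; first by rewrite expr0 in kx; lra.
exists k; split => //.
  by rewrite ltNge; apply/negP => /kmin; rewrite ltnn.
move=> [d|d] dx; first exact: kmin.
have : m ^ Negz d <= 1.
  by rewrite -[m ^ _]/((m ^+ d.+1)^-1) invf_le1 ?exprn_gt0 // exprn_ege1 // ltW.
by move=> h; have := le_lt_trans (le_trans dx h) x1; rewrite ltxx.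
Qed.

Variable alpha : nat -> R.

Lemma dstar_spec n (m := n%:R * qseq alpha n) (l2 := ln (ln n%:R) ^+ 2 : R) :
  1 < m -> 1 < n%:R / l2 ->
  exists k : nat, [/\ dstar alpha n = k.+1%:Z,
    m ^+ k < n%:R / l2 & n%:R / l2 <= m ^+ k.+1].
Proof.
move=> m1 x1; have [k [kx xk kmin]] := least_exponent m1 x1.
(* A minimum is unique, so [xget] returns it rather than its default 0. *)
exists k; split => //; rewrite /dstar; apply: xget_unique => [|d [d1 d2]].
  by split.
apply/eqP; rewrite eq_le d2 //; exact: kmin.
Qed.

Lemma limn_esup_lt (u : nat -> \bar R) (x : \bar R) : (limn_esup u < x)%E ->
  exists2 y, (y < x)%E & \forall n \near \oo, (u n <= y)%E.
Proof.
move=> /ereal_inf_lt[y [V Voo <-] yx]; exists (ereal_sup [set u n | n in V]) => //.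
by apply: filterS Voo => n Vn; apply: ereal_sup_ubound; exists n.
Qed.

Lemma limn_einf_gt0 : (0 < limn_einf (fun n => (alpha n)%:E))%E ->
  exists2 c : R, 0 < c & \forall n \near \oo, c <= alpha n.
Proof.
rewrite /limn_einf oppe_gt0 => /limn_esup_lt[[y||]//=].
- rewrite lte_fin => y0 H; exists (- y); first by rewrite oppr_gt0.
  by apply: filterS H => n /=; rewrite lee_fin lerNl.
- by move=> _ H; exists 1 => //; apply: filterS H.
Qed.

Lemma limn_esup_lty : (limn_esup (fun n => (alpha n)%:E) < +oo)%E ->
  exists2 c : R, 0 < c & \forall n \near \oo, alpha n <= c.
Proof.
move=> /limn_esup_lt[[y||]//= _ H]; last by exists 1 => //; apply: filterS H.
exists (Num.max 1 y); first by rewrite lt_max ltr01.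
by apply: filterS H => n; rewrite lee_fin le_max => ->; rewrite orbT.
Qed.

End Threshold.

(** * Asymptotics in n *)

Section Asymptotics.
Context (R : realType).
Implicit Types f : nat -> R.

Lemma cvgr_ln f : f @ \oo --> +oo -> ln (f n) @[n --> \oo] --> +oo.
Proof.
move=> /cvgryPge h; apply/cvgryPge => A; apply: filterS (h (expR A)) => n fA.
have f0 : 0 < f n by apply: lt_le_trans fA; exact: expR_gt0.
by rewrite -[leLHS]expRK ler_ln ?posrE ?expR_gt0.
Qed.

Lemma cvgr_inv0 f : f @ \oo --> +oo -> (f n)^-1 @[n --> \oo] --> 0.
Proof.
move=> h; apply/gtr0_cvgV0 => //.
by move/cvgryPgt : h; apply.
Qed.

(** With t = ln f, one has f = exp(t / 3)^3 >= t^3 / 27, hence t^2 / f <= 27 / t. *)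
Lemma cvgr_ln_sqr_div f : f @ \oo --> +oo ->
  ln (f n) ^+ 2 / f n @[n --> \oo] --> 0.
Proof.
move=> fy; have lfy := cvgr_ln fy.
apply: (@squeeze_cvgr _ _ _ _ (fun=> 0) (fun n => 27 * (ln (f n))^-1)).
- move/cvgryPgt : (lfy) => /(_ 0) l0; move/cvgryPgt : (fy) => /(_ 0) f0.
  near=> n; have t0 : 0 < ln (f n) by near: n.
  have fn0 : 0 < f n by near: n.
  rewrite divr_ge0 ?sqr_ge0 ?(ltW fn0) //= ler_pdivrMr // mulrAC ler_pdivlMr //.
  set t := ln (f n) in t0 *; have -> : f n = expR (t / 3) ^+ 3.
    by rewrite -expRM_natr mulfVK // lnK ?posrE.
  have h : t / 3 <= expR (t / 3) by apply: le_trans (expR_ge1Dx _); rewrite lerDr.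
  have : (t / 3) ^+ 3 <= expR (t / 3) ^+ 3.
    by rewrite lerXn2r ?nnegrE ?expR_ge0 // divr_ge0 // ltW.
  by lra.
- exact: cvg_cst.
- by rewrite -(mulr0 27); apply: cvgM; [exact: cvg_cst|exact: cvgr_inv0].
Unshelve. all: by end_near. Qed.

Variable alpha : nat -> R.
Hypothesis alpha_liminf : (0 < limn_einf (fun n => (alpha n)%:E))%E.
Hypothesis alpha_limsup : (limn_esup (fun n => (alpha n)%:E) < +oo)%E.

(** The rates do not depend on t, so that t may later be chosen as a function of n; positivity of
    [d2] makes its square root an admissible t. *)
Lemma concentration : exists d1 d2 : nat -> R,
  [/\ d1 n @[n --> \oo] --> 0, d2 n @[n --> \oo] --> 0,
      \forall n \near \oo, 0 < d2 n
    & \forall n \near \oo, 0 <= qseq alpha n <= 1 /\ forall t : R, 0 < t ->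
      [/\ er_prob (qseq alpha n) (fun E : {set {set 'I_n}} =>
            t < `|(Ndist E (dstar alpha n))%:R / n%:R - (1 - lambda_seq alpha n)|)
            <= d1 n / t ^+ 2,
          er_prob (qseq alpha n) (fun E : {set {set 'I_n}} =>
            t < `|(Ndist E (dstar alpha n + 1))%:R / n%:R - lambda_seq alpha n|)
            <= 4 / t ^+ 2 * d1 n + 2 / t * d2 n
        & er_prob (qseq alpha n) (fun E : {set {set 'I_n}} =>
            t < #|~: (sphere E (dstar alpha n) :|: sphere E (dstar alpha n + 1))%SET|%:R
                / n%:R) <= d2 n / t]].
Proof.
have [c c0 ac] := limn_einf_gt0 alpha_liminf.
have [C C0 aC] := limn_esup_lty alpha_limsup.
pose l n : R := ln n%:R; pose L n : R := ln (l n).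
have ny : (n%:R : R) @[n --> \oo] --> +oo := cvgr_idn.
have ly : l n @[n --> \oo] --> +oo by exact: cvgr_ln.
have Ly : L n @[n --> \oo] --> +oo by exact: cvgr_ln.
have nV := cvgr_inv0 ny; have lV := cvgr_inv0 ly; have LV := cvgr_inv0 Ly.
have ln_n : l n ^+ 2 / n%:R @[n --> \oo] --> 0 := cvgr_ln_sqr_div ny.
have Ll : L n ^+ 2 / l n @[n --> \oo] --> 0 := cvgr_ln_sqr_div ly.
(* This is C log n / n, an upper bound for q_n, and [L4] below is (log log n)^4 / n; both are
   written as products of null sequences. *)
pose qb n := C * (l n ^+ 2 / n%:R * (l n)^-1).
have qb0 : qb n @[n --> \oo] --> 0.
  rewrite -(mulr0 C) -[X in _ * X](mulr0 (0 : R)).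
  by apply: cvgM; [exact: cvg_cst|exact: cvgM].
pose L4 n := (L n ^+ 2 / l n) ^+ 2 * (l n ^+ 2 / n%:R).
have L40 : L4 n @[n --> \oo] --> 0.
  rewrite -(mulr0 ((0 : R) ^+ 2)); apply: cvgM => //.
  by rewrite expr2; under eq_fun do rewrite expr2; exact: cvgM.
pose d1 n := 4 * n%:R^-1 + 16 * (qb n * qb n) + 32 / c * (l n)^-1 +
  264 * ((L n)^-1 * (L n)^-1).
pose d2 n := 16 / c * (L n ^+ 2 / l n) + 8 / c * (l n)^-1 +
  70 * ((L n)^-1 * (L n)^-1) + 256 * L4 n.
exists d1, d2.
have cz (a : R) (f : nat -> R) : f n @[n --> \oo] --> 0 -> a * f n @[n --> \oo] --> 0.
  by move=> f0; rewrite -(mulr0 a); apply: cvgM => //; exact: cvg_cst.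
have pz (f g : nat -> R) : f n @[n --> \oo] --> 0 -> g n @[n --> \oo] --> 0 ->
    f n + g n @[n --> \oo] --> 0.
  by move=> f0 g0; rewrite -(addr0 (0 : R)); apply: cvgD.
have mz (f g : nat -> R) : f n @[n --> \oo] --> 0 -> g n @[n --> \oo] --> 0 ->
    f n * g n @[n --> \oo] --> 0.
  by move=> f0 g0; rewrite -(mulr0 (0 : R)); apply: cvgM.
move/cvgryPge : (ly) => lge; move/cvgryPge : (Ly) => Lge.
move/cvgryPge : (ny) => nge.
split.
- apply: (pz); last by apply: (cz); exact: mz.
  apply: (pz); last by apply: (cz).
  by apply: (pz); apply: (cz) => //; exact: mz.
- apply: (pz); last by apply: (cz).
  apply: (pz); last by apply: (cz); exact: mz.
  by apply: (pz); apply: (cz).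
- near=> n.
  have l1 : 1 <= l n by near: n; exact: lge.
  have L1 : 1 <= L n by near: n; exact: Lge.
  have n1 : 1 <= n%:R :> R by near: n; exact: nge.
  have l0 : 0 < l n by lra.
  have L0 : 0 < L n by lra.
  have n0 : 0 < n%:R :> R by lra.
  by rewrite !addr_gt0 // ?mulr_gt0 ?divr_gt0 ?invr_gt0 ?exprn_gt0
    ?mulr_gt0 ?divr_gt0 ?invr_gt0 ?exprn_gt0.
near=> n.
have ca : c <= alpha n by near: n.
have aCn : alpha n <= C by near: n.
(* The threshold 2 / c makes m >= c log n at least 2. *)
have l1 : Num.max 1 (2 / c) <= l n by near: n; exact: lge.
have L1 : 1 <= L n by near: n; exact: Lge.
have n1 : 1 <= n%:R :> R by near: n; exact: nge.
have qb2 : qb n < 1 / 2 by near: n; apply: cvgr_lt qb0 _ _.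
have L41 : L4 n < 1 by near: n; apply: cvgr_lt L40 _ _.
move: l1; rewrite ge_max => /andP[l1 l2c].
have l0 : 0 < l n by lra.
have L0 : 0 < L n by lra.
have n0 : 0 < n%:R :> R by lra.
have a0 : 0 < alpha n by lra.
pose q := qseq alpha n; pose m := n%:R * q; pose l2 := L n ^+ 2.
have q0 : 0 < q by rewrite /q /qseq divr_gt0 // mulr_gt0.
have qqb : q <= qb n.
  have -> : qb n = C * l n / n%:R by rewrite /qb; field; rewrite !gt_eqF.
  by rewrite /q /qseq ler_wpM2r ?invr_ge0 ?(ltW n0) // ler_wpM2r // ltW.
have mE : m = alpha n * l n by rewrite /m /q /qseq -/(l n); field; rewrite gt_eqF.
have cm : c * l n <= m by rewrite mE ler_wpM2r // ltW.
have m2 : 2 <= m by apply: le_trans cm; rewrite mulrC -ler_pdivrMr.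
have m0 : 0 < m by lra.
have l2_1 : 1 <= l2 by rewrite /l2 exprn_ege1.
have l20 : 0 < l2 by lra.
have L4E : L4 n = l2 ^+ 2 / n%:R by rewrite /L4 /l2; field; rewrite !gt_eqF.
(* From [L4 n < 1] and [l2] >= 1 one gets l2 <= l2^2 < n. *)
have x1 : 1 < n%:R / l2.
  rewrite ltr_pdivlMr // mul1r; move: L41; rewrite L4E ltr_pdivrMr // mul1r.
  by apply: le_lt_trans; rewrite expr2 ler_peMl // ltW.
have q12 : 0 <= q <= 1 / 2 by apply/andP; split; lra.
have m1 : 1 < m by lra.
have [k [dk mk mk1]] := dstar_spec m1 x1.
have dk1 : k.+1%:Z + 1 = k.+2%:Z by rewrite -PoszD addn1.
have b1 : near_bound n q l2 <= d1 n.
  rewrite /near_bound -/m /d1; apply: lerD; last first.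
    by rewrite /l2 -invfM -expr2.
  have i1 : m^-1 <= (c * l n)^-1 by rewrite lef_pV2 ?posrE // mulr_gt0.
  apply: lerD; last first.
    by rewrite (_ : 32 / c / l n = 32 / (c * l n)) ?ler_wpM2l // invfM mulrA.
  by rewrite lerD2l ler_wpM2l // expr2 ler_pM // ltW.
have b2 : far_bound n q l2 <= d2 n.
  rewrite /far_bound -/m /d2 L4E; apply: lerD; last by rewrite mulrA.
  have i1 : m^-1 <= (c * l n)^-1 by rewrite lef_pV2 ?posrE // mulr_gt0.
  apply: lerD; last by rewrite /l2 -invfM -expr2.
  apply: lerD.
    rewrite (_ : 16 / c * (L n ^+ 2 / l n) = 16 * l2 / (c * l n)).
      by rewrite ler_wpM2l // mulr_ge0 // ltW.
    by rewrite /l2; field; rewrite !gt_eqF.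
  by rewrite (_ : 8 / c / l n = 8 / (c * l n)) ?ler_wpM2l // invfM mulrA.
split; first by rewrite -/q; apply/andP; split; lra.
move=> t t0; rewrite /lambda_seq dk dk1.
have t20 : 0 <= (t ^+ 2)^-1 by rewrite invr_ge0 sqr_ge0.
split.
- apply: le_trans (near_frac_concentration q12 m2 mk t0) _.
  by rewrite ler_wpM2r.
- apply: le_trans (next_frac_concentration q12 m2 l2_1 mk mk1 t0) _.
  by apply: lerD; rewrite ler_wpM2l // ?mulr_ge0 // ?invr_ge0 // ltW.
- apply: le_trans (far_frac_concentration q12 m2 l2_1 mk mk1 t0) _.
  by rewrite ler_wpM2r // invr_ge0 ltW.
Unshelve. all: by end_near. Qed.

(** Concentration is around the moving centre [a n]; eventually this is within eps / 2 of its limit,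
    so half of eps is left for the fluctuation. *)
Lemma er_cvg_in_prob_shift (q : nat -> R) (X : forall n, {set {set 'I_n}} -> R)
    (a : nat -> R) (c : R) :
  (\forall n \near \oo, 0 <= q n <= 1) -> a n @[n --> \oo] --> c ->
  (forall t, 0 < t -> er_prob (q n) (fun E : {set {set 'I_n}} =>
     t < `|X n E - a n|) @[n --> \oo] --> 0) ->
  er_cvg_in_prob q X c.
Proof.
move=> q01 ac H eps eps0; have e2 : 0 < eps / 2 by rewrite divr_gt0.
apply: (@squeeze_cvgr _ _ _ _ (fun=> 0) (fun n => er_prob (q n)
   (fun E : {set {set 'I_n}} => eps / 2 < `|X n E - a n|))).
- near=> n; have qn : 0 <= q n <= 1 by near: n.
  have an : `|a n - c| <= eps / 2.
    by rewrite distrC; near: n; exact: cvgr_dist_le.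
  rewrite er_probE er_exp_ge0 //= -er_probE; apply: er_prob_sub => // E h.
  have : `|X n E - c| <= `|X n E - a n| + `|a n - c|.
    by rewrite -[X in `|X|](subrKA (a n)) ler_normD.
  by lra.
- exact: cvg_cst.
- exact: H.
Unshelve. all: by end_near. Qed.

End Asymptotics.

(** * The two limits in probability and the bound on the exceptional vertices *)

Theorem theorem1p2 (R : realType) (alpha : nat -> R) (lam : R)
    (alpha_gt0 : forall n : nat, (1 <= n)%N -> 0 < alpha n)
    (alpha_liminf : (0 < limn_einf (fun n => (alpha n)%:E))%E)
    (alpha_limsup : (limn_esup (fun n => (alpha n)%:E) < +oo)%E)
    (lam01 : 0 <= lam <= 1)
    (cvg_lam : lambda_seq alpha n @[n --> \oo] --> lam) :
  [/\ er_cvg_in_prob (qseq alpha)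
        (fun n E => (Ndist E (dstar alpha n))%:R / n%:R) (1 - lam),
      er_cvg_in_prob (qseq alpha)
        (fun n E => (Ndist E (dstar alpha n + 1))%:R / n%:R) lam
    & exists2 b : nat -> R,
        b n / n%:R @[n --> \oo] --> (0 : R)
      & er_prob (qseq alpha n) (fun E : {set {set 'I_n}} =>
            #|~: (sphere E (dstar alpha n) :|: sphere E (dstar alpha n + 1))%SET|%:R
              <= b n) @[n --> \oo] --> (1 : R)].
Proof.
have [d1 [d2 [d1_0 d2_0 d2_gt0 H]]] := concentration alpha_liminf alpha_limsup.
have q01 : \forall n \near \oo, 0 <= qseq alpha n <= 1 by apply: filterS H => n [].
split.
- apply: (er_cvg_in_prob_shift (a := fun n => 1 - lambda_seq alpha n)) => //.
    by apply: cvgB => //; exact: cvg_cst.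
  move=> t t0; apply: (@squeeze_cvgr _ _ _ _ (fun=> 0) (fun n => d1 n / t ^+ 2)).
  + apply: filterS H => n [qn /(_ t t0)[-> _ _]].
    by rewrite er_probE er_exp_ge0.
  + exact: cvg_cst.
  + by rewrite -(mul0r (t ^+ 2)^-1); apply: cvgM => //; exact: cvg_cst.
- apply: (er_cvg_in_prob_shift (a := lambda_seq alpha)) => //.
  move=> t t0; apply: (@squeeze_cvgr _ _ _ _ (fun=> 0)
    (fun n => 4 / t ^+ 2 * d1 n + 2 / t * d2 n)).
  + apply: filterS H => n [qn /(_ t t0)[_ -> _]].
    by rewrite er_probE er_exp_ge0.
  + exact: cvg_cst.
  + have z : 4 / t ^+ 2 * 0 + 2 / t * 0 = 0 :> R by rewrite !mulr0 addr0.
    by rewrite -[X in _ --> X]z; apply: cvgD; apply: cvgM => //; exact: cvg_cst.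
have sqrt0 : Num.sqrt (d2 n) @[n --> \oo] --> 0.
  by rewrite -sqrtr0; apply: continuous_cvg => //; exact: sqrt_continuous.
(* Taking t = sqrt(d2 n) balances both requirements: the exceptional fraction is at most t, and this
   fails with probability at most d2 n / t = t. *)
exists (fun n => n%:R * Num.sqrt (d2 n)).
  apply: cvg_trans sqrt0; apply: near_eq_cvg; near=> n.
  have n0 : (0 < n)%N by near: n; exact: nbhs_infty_gt.
  by rewrite mulrAC divff ?mul1r // pnatr_eq0 -lt0n.
apply: (@squeeze_cvgr _ _ _ _ (fun n => 1 - Num.sqrt (d2 n)) (fun=> 1)).
- apply: filterS3 d2_gt0 (nbhs_infty_gt 0) H => n d20 n0 [qn H'].
  have s0 : 0 < Num.sqrt (d2 n) by rewrite sqrtr_gt0.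
  have [_ _ h] := H' _ s0.
  rewrite er_probC lerD2l lerN2 gerDl oppr_le0 er_probE er_exp_ge0 // andbT -er_probE.
  have sE : d2 n / Num.sqrt (d2 n) = Num.sqrt (d2 n).
    by rewrite -{1}(sqr_sqrtr (ltW d20)) expr2 mulfK ?gt_eqF.
  rewrite sE in h; apply: le_trans h; apply: er_prob_sub => // E /=.
  by rewrite -ltNge ltr_pdivlMr ?ltr0n // mulrC.
- by rewrite -[X in _ --> X]subr0; apply: cvgB => //; exact: cvg_cst.
- exact: cvg_cst.
Unshelve. all: by end_near. Qed.
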